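(* Assume: (i) $Q\subset\mathbb{R}^d$ is compact and convex, with $D>0$ such that $\|x-y\|\le D$ for all $x,y\in Q$; (ii) $f$ is convex on $Q$: $f(y)\ge f(x)+\langle\nabla f(x),y-x\rangle$ for all $x,y\in Q$; (iii) the functions $f(\cdot,\xi)$ are $L(\xi)$-smooth on $Q$, i.e. $\|\nabla f(x,\xi)-\nabla f(y,\xi)\|\le L(\xi)\|x-y\|$ for all $x,y\in Q$, and there is a constant $L$ with $L^2=\mathbb{E}[L(\xi)^2]$ (so that $f$ is $L$-smooth on $Q$); (iv) there is $\Delta>0$ with $\mathbb{E}[|\delta(x,\xi)|^2]\le\Delta^2$ for all $x\in Q$; (v) there is $\sigma_\nabla\ge0$ with $\mathbb{E}[\|\nabla f(x,\xi)-\nabla f(x)\|^2]\le\sigma_\nabla^2$ for all $x\in Q$; (vi) in the one point feedback case, there is $\sigma_f\ge0$ with $\mathbb{E}[|f(x,\xi)-f(x)|^2]\le\sigma_f^2$ for all $x\in Q$. One can take $\gamma_k=\frac{4}{k+8d^{3/2}}$ and $\eta_k=\frac{4}{(k+8d^{3/2})^{2/3}}$; then the stochastic algorithm FW via JAGUAR (see context) has the convergence rate $$F_N=\mathcal{O}\left(\frac{LD^2+d\sigma_fD/\tau+d\sigma_\nabla D+\sqrt d\,F_0}{(N+8d^{3/2})^{1/3}}+\sqrt d\,LD\tau+\frac{\sqrt d\,\Delta D}{\tau}\right),$$ where $F_N:=\mathbb{E}[f(x^N)-f^*]$, $f^*:=\min_{x\in Q}f(x)$ (in particular $F_0=f(x^0)-f^*$).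 In the two point feedback case, $\sigma_f^2=0$.
   Context: $\|\cdot\|$ is the Euclidean norm on $\mathbb{R}^d$ and $e_1,\dots,e_d$ the standard basis; $\mathcal{O}(\cdot)$ hides an absolute constant; $\tau>0$ is a smoothing parameter. $\xi$ is a random vector with distribution $\pi$; the problem is $\min_{x\in Q}f(x)$ with $f(x):=\mathbb{E}_{\xi\sim\pi}[f(x,\xi)]$, all functions being differentiable in $x$. Only noisy values $f_\delta(x,\xi):=f(x,\xi)+\delta(x,\xi)$ are available, where $\delta(x,\xi)$ is the oracle noise. Feedback: in the one point feedback case each pair $\xi^+,\xi^-$ consists of independent samples from $\pi$; in the two point feedback case $\xi^+=\xi^-\sim\pi$. Put $\widetilde\nabla_i f_\delta(x,\xi^\pm):=\frac{f_\delta(x+\tau e_i,\xi^+)-f_\delta(x-\tau e_i,\xi^-)}{2\tau}e_i$. Stochastic algorithm FW via JAGUAR: start from $x^0\in Q$ and $h^0=g^0=\sum_{i=1}^d\widetilde\nabla_i f_\delta(x^0,\xi_i^\pm)$. For $k=0,1,2,\dots$: sample $i_k$ uniformly from $\{1,\dots,d\}$ and a pair $\xi_k^\pm$, independently; set $h^{k+1}=h^k-\langle h^k,e_{i_k}\rangle e_{i_k}+\widetilde\nabla_{i_k}f_\delta(x^k,\xi_k^\pm)$; $\rho^k=h^k-d\langle h^k,e_{i_k}\rangle e_{i_k}+d\,\widetilde\nabla_{i_k}f_\delta(x^k,\xi_k^\pm)$; $g^{k+1}=(1-\eta_k)g^k+\eta_k\rho^k$; $s^k\in\arg\min_{s\in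 Q}\langle s,g^{k+1}\rangle$; $x^{k+1}=x^k+\gamma_k(s^k-x^k)$.
   Formalization: Smoothness (iii) and the noise bound (iv) are assumed not only on Q but on all points x+te_i with x in Q and |t|≤τ, since the oracle is queried at x±τe_i; with these bounds only on Q the claim fails (d=1, Q=[0,1], f=x, τ=2, δ=−2x off Q). *)

(* Defs.v *)
From HB Require Import structures.
From mathcomp Require Import all_boot all_order all_algebra.
From mathcomp Require Import all_classical all_reals all_analysis.

Set Implicit Arguments.
Unset Strict Implicit.
Unset Printing Implicit Defensive.

Import Order.TTheory GRing.Theory Num.Theory.
Import numFieldNormedType.Exports.

Local Open Scope classical_set_scope.
Local Open Scope ring_scope.

Section Euclidean.
Context {R : realType} {d : nat}.
Implicit Types (u v x : 'rV[R]_d) (F : 'rV[R]_d -> R) (Q : set 'rV[R]_d).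

Definition dot u v : R := \sum_(i < d) u 0 i * v 0 i.

(* The norm carried by the library's instance on 'rV[R]_d is the sup norm;
   it induces the same topology and the same differentials, but all
   quantitative estimates are in the Euclidean norm. *)
Definition enorm u : R := Num.sqrt (dot u u).

Definition evec (i : 'I_d) : 'rV[R]_d := delta_mx 0 i.

Definition grad F x : 'rV[R]_d := \row_i 'D_(evec i) (F : 'rV[R]_d -> R^o) x.

Definition smooth_on (A : set 'rV[R]_d) F (L : R) : Prop :=
  forall x y, A x -> A y -> enorm (grad F x - grad F y) <= L * enorm (x - y).

Definition is_min_on Q F (m : R) : Prop := (F @` Q) m /\ lbound (F @` Q) m.

Definition is_lin_argmin Q v (s : 'rV[R]_d) : Prop :=
  Q s /\ forall y, Q y -> dot s v <= dot y v.

(* The finite-difference oracle evaluates its functions at x + tau e_i and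
   x - tau e_i, which may lie outside Q even when x is in Q. This set consists
   of Q together with the segments [x - tau e_i, x + tau e_i]. *)
Definition fd_enlargement Q (tau : R) : set 'rV[R]_d :=
  [set y | exists x i t, [/\ Q x, `|t| <= tau & y = x + t *: evec i]].

End Euclidean.

(* R^d with the sigma-algebra generated by the coordinates, that is, its Borel
   sigma-algebra. *)
Definition borel_rV (R : realType) (d : nat) :=
  g_sigma_algebraType
    (g_sigma_preimage (fun (i : 'I_d) (x : 'rV[R]_d) => x 0 i)).

Definition jointly_measurable (R : realType) (d : nat) (dX : measure_display)
    (Xi : measurableType dX) (F : 'rV[R]_d -> Xi -> R) : Prop :=
  measurable_fun setT (fun p : borel_rV R d * Xi => F p.1 p.2).

Definition mean (R : realType) (d : nat) (dX : measure_display)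
    (Xi : measurableType dX) (pi : probability Xi R)
    (f : 'rV[R]_d -> Xi -> R) (x : 'rV[R]_d) : R :=
  fine ('E_pi[f x])%E.

Inductive feedback := OnePoint | TwoPoint.

Section Algorithm.
Context {R : realType} {d : nat} {dO dX : measure_display}
  {Omega : measurableType dO} {Xi : measurableType dX}.
Implicit Types (P : probability Omega R) (pi : probability Xi R).

Definition has_law P pi (X : Omega -> Xi) : Prop :=
  forall B, measurable B -> P (X @^-1` B) = pi B.

Definition feedback_pair (fb : feedback) P pi (xip xim : Omega -> Xi) : Prop :=
  match fb with
  | OnePoint =>
      [/\ has_law P pi xip, has_law P pi xim &
          forall B B', measurable B -> measurable B' ->
            P (xip @^-1` B `&` xim @^-1` B') =
            (P (xip @^-1` B) * P (xim @^-1` B'))%E]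
  | TwoPoint => has_law P pi xip /\ xip = xim
  end.

Definition measurable_wrt (G : set_system Omega) (dT : measure_display)
    (T : measurableType dT) (X : Omega -> T) : Prop :=
  forall B, measurable B -> G (X @^-1` B).

(* Fk k is the information available before step k; the initial pairs, one
   for each coordinate, are part of Fk 0. The product formula says that the
   index of step k, the sample pair of step k and the past Fk k are mutually
   independent. *)
Record jaguar_sampling (fb : feedback) P pi
    (Fk : nat -> set_system Omega)
    (xi0p xi0m : 'I_d -> Omega -> Xi)
    (idx : nat -> Omega -> 'I_d) (xip xim : nat -> Omega -> Xi) : Prop := {
  filtration_sigma : forall k, sigma_algebra setT (Fk k) ;
  filtration_measurable : forall k, Fk k `<=` measurable ;
  filtration_ndecr : forall k, Fk k `<=` Fk k.+1 ;
  init_adapted : forall i,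
    measurable_wrt (Fk 0%N) (xi0p i) /\ measurable_wrt (Fk 0%N) (xi0m i) ;
  init_pair : forall i, feedback_pair fb P pi (xi0p i) (xi0m i) ;
  index_adapted : forall k i, Fk k.+1 (idx k @^-1` [set i]) ;
  sample_adapted : forall k,
    measurable_wrt (Fk k.+1) (xip k) /\ measurable_wrt (Fk k.+1) (xim k) ;
  index_uniform : forall k i, P (idx k @^-1` [set i]) = (d%:R^-1)%:E ;
  sample_pair : forall k, feedback_pair fb P pi (xip k) (xim k) ;
  step_independent : forall k A i B B',
    Fk k A -> measurable B -> measurable B' ->
    P (A `&` (idx k @^-1` [set i] `&` (xip k @^-1` B `&` xim k @^-1` B'))) =
    (P A * (P (idx k @^-1` [set i]) * P (xip k @^-1` B `&` xim k @^-1` B')))%E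
}.

(* Central difference along e_i of a stochastic zeroth-order oracle F, with
   independent or shared randomness in its two evaluations. *)
Definition coord_diff (F : 'rV[R]_d -> Xi -> R) (tau : R) (i : 'I_d)
    (x : 'rV[R]_d) (xp xm : Xi) : 'rV[R]_d :=
  ((F (x + tau *: evec i) xp - F (x - tau *: evec i) xm) / (2 * tau))
    *: evec i.

Definition jaguar_rho (F : 'rV[R]_d -> Xi -> R) (tau : R) (i : 'I_d)
    (x h : 'rV[R]_d) (xp xm : Xi) : 'rV[R]_d :=
  h - (d%:R * dot h (evec i)) *: evec i + d%:R *: coord_diff F tau i x xp xm.

(* Any selection from the argmin is allowed for s k, provided it is made from
   the information available when g k.+1 has been computed. *)
Record fw_jaguar (Q : set 'rV[R]_d) (F : 'rV[R]_d -> Xi -> R) (tau : R)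
    (gamma eta : nat -> R) (Fk : nat -> set_system Omega)
    (xi0p xi0m : 'I_d -> Omega -> Xi)
    (idx : nat -> Omega -> 'I_d) (xip xim : nat -> Omega -> Xi)
    (x0 : 'rV[R]_d) (x h g s : nat -> Omega -> 'rV[R]_d) : Prop := {
  init_x : forall w, x 0%N w = x0 ;
  init_h : forall w,
    h 0%N w = \sum_(i < d) coord_diff F tau i x0 (xi0p i w) (xi0m i w) ;
  init_g : forall w, g 0%N w = h 0%N w ;
  step_h : forall k w,
    h k.+1 w = h k w - dot (h k w) (evec (idx k w)) *: evec (idx k w)
               + coord_diff F tau (idx k w) (x k w) (xip k w) (xim k w) ;
  step_g : forall k w,
    g k.+1 w = (1 - eta k) *: g k w
               + eta k *: jaguar_rho F tau (idx k w) (x k w) (h k w)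
                            (xip k w) (xim k w) ;
  step_s : forall k w, is_lin_argmin Q (g k.+1 w) (s k w) ;
  s_adapted : forall k j, measurable_wrt (Fk k.+1) (fun w => s k w 0 j) ;
  step_x : forall k w, x k.+1 w = x k w + gamma k *: (s k w - x k w)
}.

End Algorithm.

Definition jaguar_gamma (R : realType) (d k : nat) : R :=
  4 / (k%:R + 8 * d%:R `^ (3 / 2)).

Definition jaguar_eta (R : realType) (d k : nat) : R :=
  4 / (k%:R + 8 * d%:R `^ (3 / 2)) `^ (2 / 3).

(* Main.v *)
Require Import Defs.
From HB Require Import structures.
From mathcomp Require Import all_boot all_order all_algebra.
From mathcomp Require Import all_classical all_reals all_analysis measurable_realfun.
From mathcomp Require Import ring lra.

Set Implicit Arguments.
Unset Strict Implicit.
Unset Printing Implicit Defensive.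

Import Order.TTheory GRing.Theory Num.Theory.
Import numFieldNormedType.Exports.

Local Open Scope classical_set_scope.
Local Open Scope ring_scope.

(* Let H_k, e_k and F_k be the mean squared error of the memory h^k, the mean
   squared error of the average g^k (both as estimators of grad f(x^k)), and the
   mean gap. A coordinate step refreshes one random entry of h^k, so H_k
   contracts by 1 - 1/(2d). Next, rho^k is a conditionally almost unbiased
   estimator of the gradient whose variance is controlled by d H_k, so e_k
   contracts by 1 - eta_k up to the squared bias. Finally, F_{k+1} is at most
   (1 - gamma_k) F_k + gamma_k D sqrt(E|g^{k+1} - grad f(x^k)|^2)
   + L D^2 gamma_k^2.
   With y_k = (k + 8 d^(3/2))^(1/3), the step sizes are gamma_k = 4 / y_k^3 and
   eta_k = 4 / y_k^2, and the three recursions keep H_k bounded,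
   e_k = O(bias^2 + 1 / y_k^2) and F_k = O(bias D + 1 / y_k). *)

(** Two tensions shape the argument. First, [memory_step] and [average_step] compare the new
    estimators with the gradient at [x k], while the recursions need the gradient at [x k.+1]. The
    drift of the gradient, at most [L D gamma_k], is split off by Young's inequality, and its weight
    ([1/(2d)] for the memory, [eta_k/2] for the average) spends part of the contraction just gained.
    Second, the bias of the finite differences is not averaged out, so it survives as a floor in the
    bounds on [g k] and on the gap, while the rest decays. The offset [8 d^(3/2)] makes
    [y_0 = 2 sqrt d]. Thus [4 d / y_k^2 <= 1] always, with equality at [k = 0]; the equality starts
    the inductions and is the source of the factor [sqrt d] in front of [F_0]. Conditioning on the
    past is done by Tonelli with the past frozen. The error integrals stay in the extended reals, so
    the induction yields their finiteness together with their bounds. *)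

(** * Square integrable random variables and their moments *)

Section SquareIntegrable.
Context d (T : measurableType d) (R : realType) (P : probability T R).
Implicit Types X Y : T -> R.

(** Finiteness is asked of the extended integral, because the real-valued integral is its [fine]
    part and would turn an infinite second moment into 0. *)
Definition square_integrable X :=
  measurable_fun setT X /\ (\int[P]_w ((X w) ^+ 2)%:E < +oo)%E.

Lemma square_integrable_sqr X : square_integrable X ->
  P.-integrable setT (EFin \o (fun w => X w ^+ 2)).
Proof.
move=> [mX Xoo]; apply/integrableP; split.
  by apply/measurable_EFinP; exact: measurable_funX.
rewrite (eq_integral (fun w => ((X w) ^+ 2)%:E))//= => w _.
by rewrite ger0_norm// sqr_ge0.
Qed.

Lemma integrable_cst_prob (c : R) : P.-integrable setT (EFin \o cst c).
Proof. exact: finite_measure_integrable_cst. Qed.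

Lemma square_integrable_integrable X : square_integrable X ->
  P.-integrable setT (EFin \o X).
Proof.
move=> sX; have iX := square_integrable_sqr sX.
have i1 := integrableD measurableT (integrable_cst_prob 1) iX.
apply: le_integrable i1 => //; first by apply/measurable_EFinP; exact: sX.1.
move=> w _ /=; rewrite lee_fin [leRHS]ger0_norm ?addr_ge0 ?sqr_ge0//.
(* Expanding this square gives [|X| <= X^2 + 1/4], below the integrable function [1 + X^2]. *)
have : 0 <= (`|X w| - 1 / 2) ^+ 2 by exact: sqr_ge0.
have -> : X w ^+ 2 = `|X w| ^+ 2 by rewrite real_normK ?num_real.
nra.
Qed.

Lemma square_integrable_cst (c : R) : square_integrable (cst c).
Proof.
split=> //; have := integrable_cst_prob (c ^+ 2) => /integrableP[_].
by rewrite (eq_integral (fun w => (c ^+ 2)%:E))//= => w _;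
  rewrite ger0_norm// sqr_ge0.
Qed.

Lemma square_integrable_le X Y : measurable_fun setT X ->
  (forall w, `|X w| <= Y w) -> square_integrable Y -> square_integrable X.
Proof.
move=> mX XY [mY Yoo]; split=> //; apply: le_lt_trans Yoo.
apply: ge0_le_integral => //.
- by move=> w _; rewrite lee_fin sqr_ge0.
- by apply/measurable_EFinP; exact: measurable_funX.
- by apply/measurable_EFinP; exact: measurable_funX.
move=> w _; rewrite lee_fin -[X w ^+ 2]real_normK ?num_real//.
by rewrite ler_sqr ?nnegrE ?(le_trans _ (XY w)).
Qed.

Lemma square_integrableZ (c : R) X : square_integrable X ->
  square_integrable (fun w => c * X w).
Proof.
move=> [mX Xoo]; split; first exact: measurable_funM.
have := integrableZl measurableT (c ^+ 2) (square_integrable_sqr (conj mX Xoo)).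
move=> /integrableP[_]; congr (_ < _)%E; apply: eq_integral => w _ /=.
by rewrite exprMn ger0_norm// mulr_ge0 ?sqr_ge0.
Qed.

Lemma square_integrableD X Y : square_integrable X -> square_integrable Y ->
  square_integrable (fun w => X w + Y w).
Proof.
move=> sX sY; split; first exact: measurable_funD sX.1 sY.1.
have := integrableD measurableT
  (integrableZl measurableT 2 (square_integrable_sqr sX))
  (integrableZl measurableT 2 (square_integrable_sqr sY)).
move=> /integrableP[_]; apply: le_lt_trans; apply: ge0_le_integral => //.
- by move=> w _; rewrite lee_fin sqr_ge0.
- by apply/measurable_EFinP/measurable_funX/(measurable_funD sX.1 sY.1).
- apply/measurable_EFinP; apply: measurableT_comp => //.
  by apply: measurable_funD; apply: measurable_funM => //;
    apply: measurable_funX; [exact: sX.1|exact: sY.1].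
move=> w _ /=; rewrite lee_fin (le_trans _ (ler_norm _))//.
by have := sqr_ge0 (X w - Y w); nra.
Qed.

Lemma square_integrableB X Y : square_integrable X -> square_integrable Y ->
  square_integrable (fun w => X w - Y w).
Proof.
move=> sX sY; have := square_integrableD sX (square_integrableZ (-1) sY).
by under eq_fun do rewrite mulN1r.
Qed.

Lemma EFin_Rintegral X : P.-integrable setT (EFin \o X) ->
  ((\int[P]_w X w)%:E = \int[P]_w (X w)%:E)%E.
Proof. by move=> iX; rewrite fineK// integrable_fin_num. Qed.

Lemma EFin_mean_sqr X : square_integrable X ->
  ((\int[P]_w (X w ^+ 2))%:E = \int[P]_w ((X w) ^+ 2)%:E)%E.
Proof. by move=> /square_integrable_sqr/EFin_Rintegral. Qed.

Lemma Rintegral_prob_cst (c : R) : \int[P]_w c = c.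
Proof. by rewrite /Rintegral integral_cst// [X in (_ * X)%E]probability_setT mule1. Qed.

Lemma meanD X Y : square_integrable X -> square_integrable Y ->
  \int[P]_w (X w + Y w) = \int[P]_w X w + \int[P]_w Y w.
Proof. by move=> sX sY; rewrite RintegralD//;
  exact: square_integrable_integrable. Qed.

Lemma meanB X Y : square_integrable X -> square_integrable Y ->
  \int[P]_w (X w - Y w) = \int[P]_w X w - \int[P]_w Y w.
Proof. by move=> sX sY; rewrite RintegralB//;
  exact: square_integrable_integrable. Qed.

Lemma meanZ (c : R) X : square_integrable X ->
  \int[P]_w (c * X w) = c * \int[P]_w X w.
Proof. by move=> sX; rewrite RintegralZl//;
  exact: square_integrable_integrable. Qed.

(** A coordinate step turns a squared norm into a polynomial of degree two in one scalar noise; this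
    is the shape in which such a polynomial is integrated later. *)
Lemma mean_affine2 (a p k : R) X : square_integrable X ->
  \int[P]_w (a + p * X w + k * X w ^+ 2) =
  a + p * \int[P]_w X w + k * \int[P]_w (X w ^+ 2).
Proof.
move=> sX; have i1 := square_integrable_integrable (square_integrableZ p sX).
have i2 : P.-integrable setT (EFin \o (fun w => k * X w ^+ 2)).
  exact: integrableZl (square_integrable_sqr sX).
rewrite RintegralD// ?RintegralD// ?RintegralZl ?Rintegral_prob_cst//.
- exact: square_integrable_sqr.
- exact: square_integrable_integrable.
- exact: integrable_cst_prob.
exact: integrableD (integrable_cst_prob a) i1.
Qed.

Lemma integral_affine2 (a p k : R) X : square_integrable X ->
  (\int[P]_w (a + p * X w + k * X w ^+ 2)%:E =
  (a + p * \int[P]_w X w + k * \int[P]_w (X w ^+ 2))%:E)%E.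
Proof.
move=> sX; rewrite -mean_affine2// EFin_Rintegral//.
have i1 := square_integrable_integrable (square_integrableZ p sX).
have i2 := integrableZl measurableT k (square_integrable_sqr sX).
exact: integrableD (integrableD _ (integrable_cst_prob a) i1) i2.
Qed.

(** The variance, expanded as the mean of [(X - c)^2] with [c] the mean of [X], is nonnegative. *)
Lemma sqr_mean_le X : square_integrable X ->
  (\int[P]_w X w) ^+ 2 <= \int[P]_w (X w ^+ 2).
Proof.
move=> sX; set c := \int[P]_w X w.
have : 0 <= \int[P]_w (c ^+ 2 + (- 2 * c) * X w + 1 * X w ^+ 2).
  apply: Rintegral_ge0 => w _; have := sqr_ge0 (X w - c); lra.
rewrite mean_affine2// -/c; lra.
Qed.

Lemma mean_sqr_le X (c : R) : (\int[P]_w ((X w) ^+ 2)%:E <= c%:E)%E ->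
  \int[P]_w (X w ^+ 2) <= c.
Proof.
have : (0 <= \int[P]_w ((X w) ^+ 2)%:E)%E.
  by apply: integral_ge0 => w _; rewrite lee_fin sqr_ge0.
by rewrite /Rintegral; case: (\int[P]_w _)%E.
Qed.

Lemma le_mean X Y : P.-integrable setT (EFin \o X) ->
  P.-integrable setT (EFin \o Y) -> (forall w, X w <= Y w) ->
  \int[P]_w X w <= \int[P]_w Y w.
Proof. by move=> *; exact: le_Rintegral. Qed.

End SquareIntegrable.

(** * Euclidean geometry and first-order expansion along a coordinate *)

Section EuclideanSpace.
Context {R : realType} {d : nat}.
Implicit Types (u v w x : 'rV[R]_d) (F : 'rV[R]_d -> R).

Lemma dotC u v : dot u v = dot v u.
Proof. by apply: eq_bigr => i _; rewrite mulrC. Qed.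

Lemma dotDl u v w : dot (u + v) w = dot u w + dot v w.
Proof. by rewrite -big_split/=; apply: eq_bigr => i _; rewrite mxE mulrDl. Qed.

Lemma dotZl (c : R) u v : dot (c *: u) v = c * dot u v.
Proof. by rewrite big_distrr/=; apply: eq_bigr => i _; rewrite mxE mulrA. Qed.

Lemma dotNl u v : dot (- u) v = - dot u v.
Proof. by rewrite -scaleN1r dotZl mulN1r. Qed.

Lemma dotBl u v w : dot (u - v) w = dot u w - dot v w.
Proof. by rewrite dotDl dotNl. Qed.

Lemma dotDr u v w : dot w (u + v) = dot w u + dot w v.
Proof. by rewrite !(dotC w) dotDl. Qed.

Lemma dotZr (c : R) u v : dot v (c *: u) = c * dot v u.
Proof. by rewrite !(dotC v) dotZl. Qed.

Lemma dotBr u v w : dot w (u - v) = dot w u - dot w v.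
Proof. by rewrite !(dotC w) dotBl. Qed.

Lemma dot_ge0 u : 0 <= dot u u.
Proof. by apply: sumr_ge0 => i _; rewrite -expr2 sqr_ge0. Qed.

Lemma enorm_ge0 u : 0 <= enorm u.
Proof. exact: sqrtr_ge0. Qed.

Lemma enorm_sqr u : enorm u ^+ 2 = \sum_i u 0 i ^+ 2.
Proof. by rewrite sqr_sqrtr ?dot_ge0//; apply: eq_bigr => i _;
  rewrite expr2. Qed.

Lemma enorm_sqr_dot u : enorm u ^+ 2 = dot u u.
Proof. by rewrite sqr_sqrtr ?dot_ge0. Qed.

Lemma coord_le_enorm u i : `|u 0 i| <= enorm u.
Proof.
rewrite -(ler_sqr (normr_ge0 _) (enorm_ge0 _)) real_normK ?num_real//.
by rewrite enorm_sqr (bigD1 i)//= lerDl sumr_ge0// => j _; rewrite sqr_ge0.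
Qed.

Lemma enormZ (c : R) u : enorm (c *: u) = `|c| * enorm u.
Proof. by rewrite /enorm dotZl dotZr mulrA -expr2 sqrtrM ?sqr_ge0// sqrtr_sqr. Qed.

Lemma evecE (i j : 'I_d) : (evec i : 'rV[R]_d) 0 j = (j == i)%:R.
Proof. by rewrite mxE eqxx. Qed.

Lemma dot_evec u i : dot u (evec i) = u 0 i.
Proof.
rewrite /dot (bigD1 i)//= evecE eqxx mulr1 big1 ?addr0// => j /negbTE ji.
by rewrite evecE ji mulr0.
Qed.

Lemma enorm_evec i : enorm (evec i : 'rV[R]_d) = 1.
Proof. by rewrite /enorm dot_evec evecE eqxx sqrtr1. Qed.

Lemma cauchy_schwarz u v : dot u v <= enorm u * enorm v.
Proof.
have uv0 : 0 <= enorm u * enorm v by rewrite mulr_ge0 ?enorm_ge0.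
have [u0|u0] := eqVneq (enorm u) 0.
  suff -> : dot u v = 0 by [].
  rewrite /dot big1// => i _; have := coord_le_enorm u i.
  by rewrite u0 normr_le0 => /eqP->; rewrite mul0r.
have [v0|v0] := eqVneq (enorm v) 0.
  suff -> : dot u v = 0 by [].
  rewrite /dot big1// => i _; have := coord_le_enorm v i.
  by rewrite v0 normr_le0 => /eqP->; rewrite mulr0.
have pu : 0 < enorm u by rewrite lt_neqAle eq_sym u0 enorm_ge0.
have pv : 0 < enorm v by rewrite lt_neqAle eq_sym v0 enorm_ge0.
(* With [p = |u|] and [q = |v|], the squared norm of [q u - p v] is [2 p q (p q - <u, v>)], and
   [p q] is positive here. *)
have := dot_ge0 (enorm v *: u - enorm u *: v).
rewrite !(dotBl, dotBr, dotZl, dotZr) -!enorm_sqr_dot (dotC v u).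
move=> H; rewrite -subr_ge0 -(pmulr_rge0 _ (mulr_gt0 pu pv)).
nra.
Qed.

(** Young's inequality, coordinate by coordinate from [c^-1 (c a - b)^2 >= 0]. The weight [c] stays
    free because the two drift estimates need different values. *)
Lemma enorm_sqrD_le (c : R) u v : 0 < c ->
  enorm (u + v) ^+ 2 <= (1 + c) * enorm u ^+ 2 + (1 + c^-1) * enorm v ^+ 2.
Proof.
move=> c0; rewrite !enorm_sqr !mulr_sumr -big_split/=; apply: ler_sum => i _.
rewrite mxE; set a := u 0 i; set b := v 0 i.
have ci : c * c^-1 = 1 by rewrite divff ?gt_eqF.
have ci0 : 0 < c^-1 by rewrite invr_gt0.
have := mulr_ge0 (ltW ci0) (sqr_ge0 (c * a - b)).
rewrite sqrrB exprMn !mulrDr mulrN.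
have -> : c^-1 * (c ^+ 2 * a ^+ 2) = c * a ^+ 2.
  by rewrite expr2 -mulrA mulKf ?gt_eqF.
have -> : c^-1 * (c * a * b *+ 2) = a * b *+ 2.
  by rewrite -!mulrA -mulrnAr mulKf ?gt_eqF.
rewrite sqrrD; lra.
Qed.

Lemma is_derive_coord F x i (t : R) :
  (forall y, differentiable (F : 'rV[R]_d -> R^o) y) ->
  is_derive t 1 (fun t : R => F (x + t *: evec i) : R^o)
    (grad F (x + t *: evec i) 0 i).
Proof.
move=> dF; have dFi := diff_derivable (v := evec i) (dF (x + t *: evec i)).
have E : (fun h : R => h^-1 *: (((fun t : R =>
  F (x + t *: evec i) : R^o) \o shift t)
      (h *: (1 : R)) - F (x + t *: evec i))) =
    (fun h : R => h^-1 *: (((F : 'rV[R]_d -> R^o) \o shift (x + t *: evec i))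
      (h *: evec i) - F (x + t *: evec i))).
  apply/funext => h /=; congr (_ *: (F _ - _)).
  by rewrite [h *: 1]mulr1 scalerDl addrCA.
by rewrite mxE; apply: DeriveDef; rewrite /derivable /derive E.
Qed.

Lemma coord_mean_value F x i (t : R) :
  (forall y, differentiable (F : 'rV[R]_d -> R^o) y) ->
  exists2 c : R, `|c| <= `|t| &
    F (x + t *: evec i) - F x = t * grad F (x + c *: evec i) 0 i.
Proof.
move=> dF; pose phi (t : R) := F (x + t *: evec i) : R^o.
have dphi (s : R) : is_derive s 1 phi (grad F (x + s *: evec i) 0 i).
  exact: is_derive_coord.
have cphi : continuous phi.
  by move=> s; apply/differentiable_continuous/derivable1_diffP;
    exact: ex_derive.
have x0 : F x = phi 0 by rewrite /phi scale0r addr0.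
have [t0|/ltW t0] := leP 0 t.
  have [c] := @MVT_segment R phi _ 0 t t0 (fun s _ => dphi s)
    (continuous_subspaceT cphi).
  rewrite in_itv/= => /andP[c0 ct]; rewrite subr0 mulrC x0 => E.
  by exists c => //; rewrite !ger0_norm.
have [c] := @MVT_segment R phi _ t 0 t0 (fun s _ => dphi s)
  (continuous_subspaceT cphi).
rewrite in_itv/= => /andP[ct c0]; rewrite sub0r mulrN mulrC x0 => E.
by exists c; rewrite ?ler0_norm ?lerN2// -[LHS]opprB E opprK.
Qed.

(** The mean value theorem moves the gradient to a point of the segment, whence the constant [|L|]
    instead of [|L|/2]. Smoothness is used only on that segment, which is what [fd_enlargement]
    contains. The absolute value is there because [L] carries no sign. *)
Lemma coord_taylor F x i (t L : R) (A : set 'rV[R]_d) :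
  (forall y, differentiable (F : 'rV[R]_d -> R^o) y) ->
  smooth_on A F L -> (forall c, `|c| <= `|t| -> A (x + c *: evec i)) ->
  `|F (x + t *: evec i) - F x - t * grad F x 0 i| <= `|L| * t ^+ 2.
Proof.
move=> dF sF xA; have [c ct ->] := coord_mean_value x i t dF.
have -> : t ^+ 2 = `|t| * `|t| by rewrite -expr2 real_normK ?num_real.
rewrite -mulrBr normrM mulrCA; apply: ler_wpM2l => //.
have -> : grad F (x + c *: evec i) 0 i - grad F x 0 i =
    (grad F (x + c *: evec i) - grad F x) 0 i by rewrite !mxE.
apply: le_trans (coord_le_enorm _ _) _.
have Ax : A x by have := xA 0; rewrite normr0 scale0r addr0; apply.
apply: le_trans (sF _ _ (xA _ ct) Ax) _.
rewrite addrAC subrr add0r enormZ enorm_evec mulr1.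
apply: (@le_trans _ _ (`|L| * `|c|)); first by rewrite ler_wpM2r// ler_norm.
exact: ler_wpM2l.
Qed.

(** A partial derivative as the limit of a sequence: this makes gradients measurable as limits of
    difference quotients, and identifies the gradient of the mean in [grad_mean]. *)
Lemma grad_seq_cvg F x i :
  differentiable (F : 'rV[R]_d -> R^o) x ->
  (fun n => n.+1%:R * (F (x + n.+1%:R^-1 *: evec i) - F x)) @ \oo -->
  grad F x 0 i.
Proof.
move=> /diff_derivable => /(_ (evec i)) dF; rewrite mxE.
have h0 : @harmonic R @ \oo --> (0 : R)^'.
  move=> A A0; have : \forall n \near \oo, harmonic n != (0 : R) ->
    A (harmonic n).
    exact: cvg_harmonic A0.
  by apply: filterS => n; apply; rewrite gt_eqF// harmonic_gt0.
have := cvg_comp _ _ h0 dF; apply: cvg_trans; apply: near_eq_cvg.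
by near=> n => /=; rewrite /harmonic invrK (addrC x).
Unshelve. all: by end_near. Qed.
End EuclideanSpace.

(** * Exchange of gradient and expectation, smoothness of the mean *)

Section StochasticGradient.
Context (R : realType) (d : nat) (dX : measure_display) (Xi : measurableType dX).
Context (pi : probability Xi R) (f : 'rV[R]_d -> Xi -> R) (Lxi : Xi -> R).
Context (Q : set 'rV[R]_d) (L tau : R).
Hypothesis tau0 : 0 < tau.
Hypothesis mf : jointly_measurable f.
Hypothesis intf : forall x, pi.-integrable setT (EFin \o f x).
Hypothesis df : forall xi x, differentiable (f ^~ xi : 'rV[R]_d -> R^o) x.
Hypothesis dm : forall x, differentiable (mean pi f : 'rV[R]_d -> R^o) x.
Hypothesis sf : forall xi, smooth_on (fd_enlargement Q tau) (f ^~ xi) (Lxi xi).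
Hypothesis mL : measurable_fun setT Lxi.
Hypothesis L0 : 0 <= L.
Hypothesis EL : (\int[pi]_xi ((Lxi xi) ^+ 2)%:E = (L ^+ 2)%:E)%E.

Lemma jointly_measurable_section (F : 'rV[R]_d -> Xi -> R) x :
  jointly_measurable F -> measurable_fun setT (F x).
Proof. by move=> mF; exact: (measurable_fun_pair2 (x : borel_rV R d) mF). Qed.

Lemma meanE x : mean pi f x = \int[pi]_xi f x xi.
Proof. by rewrite /mean unlock. Qed.

Lemma measurable_partial x i :
  measurable_fun setT (fun xi => grad (f ^~ xi) x 0 i).
Proof.
apply: (measurable_fun_cvg (h := fun n xi =>
  n.+1%:R * (f (x + n.+1%:R^-1 *: evec i) xi - f x xi))).
  by move=> n; apply: measurable_funM => //; apply: measurable_funB;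
    exact: jointly_measurable_section.
by move=> xi _; apply: (@grad_seq_cvg R d (f ^~ xi)).
Qed.

Lemma fd_enlargement_line x i c : Q x -> `|c| <= tau ->
  fd_enlargement Q tau (x + c *: evec i).
Proof. by move=> Qx ct; exists x, i, c. Qed.

Lemma square_integrable_normLxi : square_integrable pi (fun xi => `|Lxi xi|).
Proof.
split; first exact: measurableT_comp.
by under eq_integral do rewrite real_normK ?num_real//; rewrite EL ltry.
Qed.

Definition taylor_rem x i (t : R) xi :=
  f (x + t *: evec i) xi - f x xi - t * grad (f ^~ xi) x 0 i.

Lemma taylor_rem_le x i t xi : Q x -> `|t| <= tau ->
  `|taylor_rem x i t xi| <= t ^+ 2 * `|Lxi xi|.
Proof.
move=> Qx tt; rewrite mulrC;
  apply: (coord_taylor (F := f ^~ xi)) (sf xi) _ => //.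
by move=> c ct; apply: fd_enlargement_line => //; exact: le_trans tt.
Qed.

Lemma square_integrable_taylor_rem x i t : Q x -> `|t| <= tau ->
  square_integrable pi (taylor_rem x i t).
Proof.
move=> Qx tt.
apply: square_integrable_le (square_integrableZ (t ^+ 2) square_integrable_normLxi).
  apply: measurable_funB; last first.
    by apply: measurable_funM => //; exact: measurable_partial.
  by apply: measurable_funB; exact: jointly_measurable_section.
by move=> xi; exact: taylor_rem_le.
Qed.

(** The Taylor identity at [t = tau] is solved for the partial derivative: it is [tau^-1] times two
    integrable values of [f] minus a square integrable remainder. *)
Lemma integrable_partial x i : Q x ->
  pi.-integrable setT (EFin \o (fun xi => grad (f ^~ xi) x 0 i)).
Proof.
move=> Qx; have tt : `|tau| <= tau by rewrite gtr0_norm.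
have irem := square_integrable_integrable (square_integrable_taylor_rem i Qx tt).
have idiff := integrableB measurableT
  (integrableB measurableT (intf (x + tau *: evec i)) (intf x)) irem.
have := integrableZl measurableT tau^-1 idiff.
congr (integrable _ _ _); apply/funext => xi /=; congr EFin.
by rewrite /taylor_rem subKr mulKf// gt_eqF.
Qed.

(** Integrating the Taylor bound shows that the mean objective has increment [t c] up to [t^2 K],
    where [c] is the expected partial derivative. Dividing by [t = 1/(n+1)] sends the difference
    quotients to [c]; they also tend to the gradient of the mean. *)
Lemma grad_mean x i : Q x ->
  grad (mean pi f) x 0 i = \int[pi]_xi grad (f ^~ xi) x 0 i.
Proof.
move=> Qx; set c := \int[pi]_xi _; pose K := \int[pi]_xi `|Lxi xi|.
pose u n := n.+1%:R * (mean pi f (x + n.+1%:R^-1 *: evec i) - mean pi f x).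
have ip := integrable_partial i Qx.
have taylor t : `|t| <= tau ->
    `|mean pi f (x + t *: evec i) - mean pi f x - t * c| <= t ^+ 2 * K.
  move=> tt; rewrite !meanE -RintegralB// -RintegralZl// -RintegralB//;
    first last.
  - exact: (integrableZl measurableT t ip).
  - exact: (integrableB measurableT (intf _) (intf _)).
  have sr := square_integrable_taylor_rem i Qx tt.
  apply: le_trans (le_normr_Rintegral _ _) _ => //.
    exact: square_integrable_integrable sr.
  rewrite -meanZ; last exact: square_integrable_normLxi.
  apply: le_mean.
  - by have := integrable_norm (square_integrable_integrable sr).
  - exact: square_integrable_integrable (square_integrableZ _ square_integrable_normLxi).
  by move=> xi; exact: taylor_rem_le.
have uc : u @ \oo --> c.
  apply: (@squeeze_cvgr _ _ _ _ (fun n => c - K * harmonic n)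
      (fun n => c + K * harmonic n)).
  - have : \forall n \near \oo, harmonic n <= tau.
      by apply: (cvgr_le (0 : R)) => //; exact: cvg_harmonic.
    apply: filterS => n nt; rewrite -ler_distl.
    have n0 : (0 : R) < n.+1%:R by [].
    have := taylor n.+1%:R^-1; rewrite gtr0_norm ?invr_gt0// => /(_ nt).
    have -> : K * harmonic n = n.+1%:R * (n.+1%:R^-1 ^+ 2 * K).
      by rewrite mulrA expr2 mulVKf ?gt_eqF// mulrC.
    have -> : u n - c = n.+1%:R * (mean pi f (x + n.+1%:R^-1 *: evec i) -
        mean pi f x - n.+1%:R^-1 * c) by rewrite mulrBr mulVKf ?gt_eqF.
    by move=> H; rewrite normrM (gtr0_norm n0) ler_pM2l.
  - rewrite -[X in _ --> X]subr0 -(mulr0 K).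
    by apply: cvgB; [exact: cvg_cst|apply: cvgMr; exact: cvg_harmonic].
  rewrite -[X in _ --> X]addr0 -(mulr0 K).
  by apply: cvgD; [exact: cvg_cst|apply: cvgMr; exact: cvg_harmonic].
have ug : u @ \oo --> grad (mean pi f) x 0 i by exact: grad_seq_cvg.
exact: cvg_unique ug uc.
Qed.

(** The squared mean of each coordinate difference is at most the mean of its square; summing under
    the integral restores the full norm, hence [Lxi^2], whose mean is [L^2]. *)
Lemma smooth_on_mean : smooth_on Q (mean pi f) L.
Proof.
move=> x y Qx Qy; set v := grad _ x - grad _ y.
pose X i xi := grad (f ^~ xi) x 0 i - grad (f ^~ xi) y 0 i.
have inQ z : Q z -> forall i : 'I_d, fd_enlargement Q tau z.
  by move=> Qz i; have := @fd_enlargement_line z i 0 Qz;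
    rewrite scale0r addr0 normr0; apply; exact: ltW.
have Xle xi (i : 'I_d) : \sum_j X j xi ^+ 2 <=
  (Lxi xi) ^+ 2 * enorm (x - y) ^+ 2.
  have -> : \sum_j X j xi ^+ 2 =
    enorm (grad (f ^~ xi) x - grad (f ^~ xi) y) ^+ 2.
    by rewrite enorm_sqr; apply: eq_bigr => j _; rewrite /X !mxE.
  have H := sf xi (inQ _ Qx i) (inQ _ Qy i).
  by rewrite -exprMn ler_sqr// nnegrE ?enorm_ge0// (le_trans _ H)// enorm_ge0.
have sX i : square_integrable pi (X i).
  apply: square_integrable_le (square_integrableZ (enorm (x - y))
    square_integrable_normLxi).
    by apply: measurable_funB; exact: measurable_partial.
  move=> xi; rewrite -ler_sqr ?nnegrE//; last by rewrite mulr_ge0 ?enorm_ge0.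
  rewrite real_normK ?num_real// exprMn real_normK ?num_real// mulrC.
  apply: le_trans (Xle xi i); rewrite (bigD1 i)//= lerDl sumr_ge0// => j _.
  exact: sqr_ge0.
rewrite -ler_sqr ?nnegrE ?enorm_ge0//; last by rewrite mulr_ge0 ?enorm_ge0.
rewrite exprMn enorm_sqr.
(* Placing [Q] inside [fd_enlargement Q tau] takes a coordinate, since the latter is empty when
   [d = 0]; that case is settled by the empty sum. *)
have [i0 _|] := pickP 'I_d; last first.
  move=> d0; rewrite big1 => [|i _];
    first exact: mulr_ge0 (sqr_ge0 _) (sqr_ge0 _).
  by have := d0 i.
apply: (@le_trans _ _ (\sum_i \int[pi]_xi (X i xi ^+ 2))).
  apply: ler_sum => i _; apply: le_trans (sqr_mean_le (sX i)).
  have -> : v 0 i = grad (mean pi f) x 0 i - grad (mean pi f) y 0 i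
    by rewrite !mxE.
  by rewrite !grad_mean// -RintegralB//; exact: integrable_partial.
rewrite -lee_fin -sumEFin.
under eq_bigr do rewrite EFin_mean_sqr//.
rewrite -ge0_integral_sum//; last 2 first.
  by move=> i; apply/measurable_EFinP/measurable_funX; exact: (sX i).1.
  by move=> i xi _; rewrite lee_fin sqr_ge0.
rewrite EFinM -EL muleC -ge0_integralZl//=; last 3 first.
- by apply/measurable_EFinP/measurable_funX.
- by move=> xi _; rewrite lee_fin sqr_ge0.
- by rewrite lee_fin sqr_ge0.
apply: ge0_le_integral => //.
- by move=> xi _; rewrite sumEFin lee_fin sumr_ge0// => i _; exact: sqr_ge0.
- apply: emeasurable_sum => i; apply/measurable_EFinP/measurable_funX.
  exact: (sX i).1.
- apply/measurable_EFinP/measurable_funM => //; exact: measurable_funX.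
by move=> xi _; rewrite sumEFin lee_fin mulrC; exact: Xle.
Qed.

End StochasticGradient.

(** * Inequalities between second moments *)

Section MeanSquares.
Context d (T : measurableType d) (R : realType) (P : probability T R).
Implicit Types X Y Z : T -> R.

Lemma mean_sqr_ge0 X : 0 <= \int[P]_w (X w ^+ 2).
Proof. by apply: Rintegral_ge0 => w _; exact: sqr_ge0. Qed.

Lemma mean_sqrZ (c : R) X : square_integrable P X ->
  \int[P]_w ((c * X w) ^+ 2) = c ^+ 2 * \int[P]_w (X w ^+ 2).
Proof.
move=> sX; under eq_Rintegral do rewrite exprMn.
by rewrite RintegralZl//; exact: square_integrable_sqr.
Qed.

Lemma mean_sqr_sub_le X Y Z (a b : R) : square_integrable P X ->
  square_integrable P Y -> square_integrable P Z ->
  (forall w, Z w ^+ 2 <= a * X w ^+ 2 + b * Y w ^+ 2) ->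
  \int[P]_w (Z w ^+ 2) <=
    a * \int[P]_w (X w ^+ 2) + b * \int[P]_w (Y w ^+ 2).
Proof.
move=> sX sY sZ H; have iX := square_integrable_sqr sX.
have iY := square_integrable_sqr sY; rewrite -!RintegralZl// -RintegralD//.
- apply: le_mean => //; first exact: square_integrable_sqr.
  exact: integrableD (integrableZl measurableT a iX) (integrableZl measurableT b iY).
- exact: (integrableZl measurableT a iX).
- exact: (integrableZl measurableT b iY).
Qed.

Lemma mean_sqrD_le X Y : square_integrable P X -> square_integrable P Y ->
  \int[P]_w ((X w + Y w) ^+ 2) <=
    2 * \int[P]_w (X w ^+ 2) + 2 * \int[P]_w (Y w ^+ 2).
Proof.
move=> sX sY; apply: mean_sqr_sub_le => //; first exact: square_integrableD.
by move=> w; have := sqr_ge0 (X w - Y w); lra.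
Qed.

Lemma mean_sqrB_le X Y : square_integrable P X -> square_integrable P Y ->
  \int[P]_w ((X w - Y w) ^+ 2) <=
    2 * \int[P]_w (X w ^+ 2) + 2 * \int[P]_w (Y w ^+ 2).
Proof.
move=> sX sY; apply: mean_sqr_sub_le => //; first exact: square_integrableB.
by move=> w; have := sqr_ge0 (X w + Y w); lra.
Qed.

Lemma mean_sqrD3_le X Y Z : square_integrable P X -> square_integrable P Y ->
  square_integrable P Z -> \int[P]_w ((X w + Y w + Z w) ^+ 2) <=
  3 * (\int[P]_w (X w ^+ 2) + \int[P]_w (Y w ^+ 2) + \int[P]_w (Z w ^+ 2)).
Proof.
move=> sX sY sZ; have sXY := square_integrableD sX sY.
have H : \int[P]_w ((X w + Y w + Z w) ^+ 2) <=
    (3 / 2) * \int[P]_w ((X w + Y w) ^+ 2) + 3 * \int[P]_w (Z w ^+ 2).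
  apply: mean_sqr_sub_le => //; first exact: square_integrableD.
  (* The weights 3/2 and 3 are chosen so that [X + Y], whose square costs another factor 2, also
     ends with factor 3. *)
  by move=> w; have := sqr_ge0 ((X w + Y w) / 2 - Z w); nra.
by apply: le_trans H _; have := mean_sqrD_le sX sY; nra.
Qed.
End MeanSquares.

(** * Transfer of moments from a sample to its law *)

Section Law.
Context (R : realType) (dO dX : measure_display) (Omega : measurableType dO)
  (Xi : measurableType dX) (P : probability Omega R) (pi : probability Xi R).
Context (X : Omega -> Xi) (mX : measurable_fun setT X) (lX : has_law P pi X).

Lemma ge0_integral_law (g : Xi -> \bar R) : measurable_fun setT g ->
  (forall xi, 0 <= g xi)%E -> (\int[P]_w g (X w) = \int[pi]_xi g xi)%E.
Proof.
move=> mg g0; rewrite (eq_measure_integral (pushforward P X)).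
  by rewrite ge0_integral_pushforward.
by move=> A mA _; exact/esym/lX.
Qed.

Lemma square_integrable_law (phi : Xi -> R) : square_integrable pi phi ->
  square_integrable P (phi \o X).
Proof.
move=> [mphi phioo]; split; first exact: measurableT_comp.
rewrite (ge0_integral_law (g := fun xi => (phi xi ^+ 2)%:E))//.
  by apply/measurable_EFinP; exact: measurable_funX.
by move=> xi; rewrite lee_fin sqr_ge0.
Qed.

Lemma mean_sqr_law (phi : Xi -> R) : square_integrable pi phi ->
  \int[P]_w (phi (X w) ^+ 2) = \int[pi]_xi (phi xi ^+ 2).
Proof.
move=> [mphi phioo]; congr fine.
rewrite (ge0_integral_law (g := fun xi => (phi xi ^+ 2)%:E))//.
  by apply/measurable_EFinP; exact: measurable_funX.
by move=> xi; rewrite lee_fin sqr_ge0.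
Qed.

Lemma integrable_law (phi : Xi -> R) : pi.-integrable setT (EFin \o phi) ->
  P.-integrable setT (EFin \o (phi \o X)).
Proof.
move=> /integrableP[mphi phioo]; apply/integrableP; split.
  exact: measurableT_comp mphi mX.
rewrite (ge0_integral_law (g := fun xi => `|(phi xi)%:E|%E))//.
exact: measurableT_comp.
Qed.

Lemma mean_law (phi : Xi -> R) : pi.-integrable setT (EFin \o phi) ->
  \int[P]_w phi (X w) = \int[pi]_xi phi xi.
Proof.
move=> iphi; congr fine; have /integrableP[mphi _] := iphi.
rewrite [RHS](eq_measure_integral (pushforward P X)); last first.
  by move=> A mA _; exact/esym/lX.
by rewrite integral_pushforward//; exact: integrable_law iphi.
Qed.

End Law.

(** * Bias and variance of the finite-difference oracle *)

Section OracleNoise.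
Context (R : realType) (d : nat) (dO dX : measure_display)
  (Omega : measurableType dO) (Xi : measurableType dX).
Context (P : probability Omega R) (pi : probability Xi R) (fb : feedback).
Context (f delta : 'rV[R]_d -> Xi -> R) (Lxi : Xi -> R).
Context (Q : set 'rV[R]_d) (L Delta sigma_grad sigma_f tau : R).
Hypothesis tau0 : 0 < tau.
Hypothesis mf : jointly_measurable f.
Hypothesis mdelta : jointly_measurable delta.
Hypothesis intf : forall x, pi.-integrable setT (EFin \o f x).
Hypothesis df : forall xi x, differentiable (f ^~ xi : 'rV[R]_d -> R^o) x.
Hypothesis dm : forall x, differentiable (mean pi f : 'rV[R]_d -> R^o) x.
Hypothesis sf : forall xi, smooth_on (fd_enlargement Q tau) (f ^~ xi) (Lxi xi).
Hypothesis mL : measurable_fun setT Lxi.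
Hypothesis EL : (\int[pi]_xi ((Lxi xi) ^+ 2)%:E = (L ^+ 2)%:E)%E.
Hypothesis Edelta : forall x, fd_enlargement Q tau x ->
  (\int[pi]_xi ((delta x xi) ^+ 2)%:E <= (Delta ^+ 2)%:E)%E.
Hypothesis Egrad : forall x, Q x ->
  (\int[pi]_xi (enorm (grad (f ^~ xi) x - grad (mean pi f) x) ^+ 2)%:E
    <= (sigma_grad ^+ 2)%:E)%E.
Hypothesis Ef : fb = OnePoint -> forall x, Q x ->
  (\int[pi]_xi ((f x xi - mean pi f x) ^+ 2)%:E <= (sigma_f ^+ 2)%:E)%E.
Context (xip xim : Omega -> Xi).
Hypotheses (mxip : measurable_fun setT xip) (mxim : measurable_fun setT xim).
Hypothesis pair : feedback_pair fb P pi xip xim.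

Definition oracle_noise x (i : 'I_d) (xp xm : Xi) : R :=
  ((f (x + tau *: evec i) xp + delta (x + tau *: evec i) xp)
   - (f (x - tau *: evec i) xm + delta (x - tau *: evec i) xm)) / (2 * tau)
  - grad (mean pi f) x 0 i.

(** Bounds the second moment of [EE / (2 tau)]: two Taylor remainders of second moment at most
    [tau^4 L^2] and two noise values of second moment at most [Delta^2] give
    [8 tau^4 L^2 + 8 Delta^2] for [EE], to be divided by [4 tau^2]. *)
Definition bias2 : R := 2 * (tau * L) ^+ 2 + 2 * (Delta / tau) ^+ 2.

Let lxip : has_law P pi xip.
Proof. by move: pair; case: fb => -[]. Qed.

Let lxim : has_law P pi xim.
Proof. by move: pair; case: fb => -[// ? <-]. Qed.

Definition grad_noise x i xi : R := grad (f ^~ xi) x 0 i - grad (mean pi f) x 0 i.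

Lemma square_integrable_grad_noise x i : Q x ->
  square_integrable pi (grad_noise x i).
Proof.
move=> Qx; have mg : measurable_fun setT (grad_noise x i).
  by apply: measurable_funB => //; exact: measurable_partial.
split=> //; apply: le_lt_trans (ltry (sigma_grad ^+ 2)).
apply: le_trans (Egrad Qx); apply: ge0_le_integral => //.
- by move=> w _; rewrite lee_fin sqr_ge0.
- by apply/measurable_EFinP; exact: measurable_funX.
- apply/measurable_EFinP; under eq_fun do rewrite enorm_sqr.
  apply: measurable_sum => j; apply: measurable_funX.
  under eq_fun do rewrite mxE [X in _ + X]mxE.
  by apply: measurable_funB => //; exact: measurable_partial.
move=> xi _; rewrite lee_fin /grad_noise.
have -> : grad (f ^~ xi) x 0 i - grad (mean pi f) x 0 i =
  (grad (f ^~ xi) x - grad (mean pi f) x) 0 i by rewrite !mxE.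
by rewrite -[X in X <= _]real_normK ?num_real// ler_sqr ?nnegrE ?enorm_ge0// coord_le_enorm.
Qed.

Lemma mean_grad_noise x i : Q x -> \int[pi]_xi grad_noise x i xi = 0.
Proof.
move=> Qx; rewrite RintegralB//; last 2 first.
- exact: (integrable_partial (tau := tau) (L := L) (Lxi := Lxi) (Q := Q)).
- exact: integrable_cst_prob.
rewrite Rintegral_prob_cst.
by rewrite (grad_mean (tau := tau) (L := L) (Lxi := Lxi) (Q := Q))// subrr.
Qed.

Lemma sum_grad_noise_le x : Q x ->
  \sum_i \int[pi]_xi (grad_noise x i xi ^+ 2) <= sigma_grad ^+ 2.
Proof.
move=> Qx; rewrite -lee_fin -sumEFin.
under eq_bigr do rewrite (EFin_mean_sqr (square_integrable_grad_noise _ Qx)).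
rewrite -ge0_integral_sum//; last 2 first.
  move=> i; apply/measurable_EFinP/measurable_funX.
  exact: (square_integrable_grad_noise i Qx).1.
  by move=> i xi _; rewrite lee_fin sqr_ge0.
apply: le_trans (Egrad Qx); rewrite le_eqVlt; apply/orP; left; apply/eqP.
apply: eq_integral => xi _; rewrite sumEFin enorm_sqr; congr EFin.
by apply: eq_bigr => i _; rewrite /grad_noise !mxE.
Qed.

(* The noise splits into a value part AA, which is centered and vanishes for
   two point feedback, a centered gradient part BB, and a part EE collecting the
   Taylor remainders and the oracle noise, the only one that is biased. *)
Let AA x w : R := f x (xip w) - f x (xim w).

Let AA_moments x : Q x -> [/\ square_integrable P (AA x),
  \int[P]_w AA x w = 0 & \int[P]_w (AA x w ^+ 2) <= 4 * sigma_f ^+ 2].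
Proof.
move=> Qx; move: pair Ef; case: fb => [_ /(_ erefl _ Qx) Efx|[_ xpm] _];
  last first.
  have -> : AA x = cst 0 by apply/funext => w; rewrite /AA xpm subrr.
  split; first exact: square_integrable_cst.
    by rewrite Rintegral_prob_cst.
  rewrite (_ : \int[P]_w _ = \int[P]_w (0 : R)).
    by rewrite Rintegral_prob_cst mulr_ge0// sqr_ge0.
  by apply: eq_Rintegral => w _; rewrite expr2 mul0r.
pose A xi := f x xi - mean pi f x.
have sA : square_integrable pi A.
  split; last exact: le_lt_trans Efx (ltry _).
  by apply: measurable_funB => //; exact: jointly_measurable_section.
(* Recentering both values at [mean pi f x] leaves the difference unchanged. The factor 4 then comes
   from [(p - q)^2 <= 2 p^2 + 2 q^2], each term having second moment at most [sigma_f^2]. *)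
have AAE : AA x = (fun w => A (xip w) - A (xim w)).
  by apply/funext => w; rewrite /A opprB addrA subrK.
have sp := square_integrable_law mxip lxip sA.
have sm := square_integrable_law mxim lxim sA.
split; rewrite AAE; first exact: square_integrableB.
  rewrite (meanB sp sm) (mean_law mxip lxip) ?(mean_law mxim lxim) ?subrr//;
    exact: square_integrable_integrable.
apply: le_trans (mean_sqrB_le sp sm) _.
rewrite (mean_sqr_law mxip lxip sA) (mean_sqr_law mxim lxim sA).
by have := mean_sqr_le Efx; rewrite /A; lra.
Qed.

Let BB x i w : R := grad_noise x i (xip w) + grad_noise x i (xim w).

Let BB_moments x i : Q x -> [/\ square_integrable P (BB x i),
  \int[P]_w BB x i w = 0 &
  \int[P]_w (BB x i w ^+ 2) <= 4 * \int[pi]_xi (grad_noise x i xi ^+ 2)].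
Proof.
move=> Qx; have sA := square_integrable_grad_noise i Qx.
have sp := square_integrable_law mxip lxip sA.
have sm := square_integrable_law mxim lxim sA.
split; first exact: square_integrableD sp sm.
  rewrite (meanD sp sm) (mean_law mxip lxip);
    last exact: square_integrable_integrable.
  rewrite (mean_law mxim lxim); last exact: square_integrable_integrable.
  by rewrite mean_grad_noise// addr0.
apply: le_trans (mean_sqrD_le sp sm) _.
rewrite (mean_sqr_law mxip lxip sA) (mean_sqr_law mxim lxim sA); lra.
Qed.

Let EE x i w : R := (taylor_rem f x i tau (xip w) - taylor_rem f x i (- tau) (xim w))
  + (delta (x + tau *: evec i) (xip w) - delta (x - tau *: evec i) (xim w)).

Let delta_moments y : fd_enlargement Q tau y ->
  square_integrable pi (delta y) /\ \int[pi]_xi (delta y xi ^+ 2) <= Delta ^+ 2.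
Proof.
move=> Qy; split; last exact: mean_sqr_le (Edelta Qy).
split; first exact: jointly_measurable_section.
exact: le_lt_trans (Edelta Qy) (ltry _).
Qed.

Let rem_moments x i t : Q x -> `|t| = tau ->
  square_integrable pi (taylor_rem f x i t) /\
  \int[pi]_xi (taylor_rem f x i t xi ^+ 2) <= tau ^+ 4 * L ^+ 2.
Proof.
move=> Qx tt; have tt' : `|t| <= tau by rewrite tt.
have sr : square_integrable pi (taylor_rem f x i t).
  exact: (square_integrable_taylor_rem (L := L) (Lxi := Lxi) (Q := Q) (tau := tau)).
split=> //.
have sL : square_integrable pi Lxi by split=> //; rewrite EL ltry.
have -> : L ^+ 2 = \int[pi]_xi (Lxi xi ^+ 2).
  by apply: EFin_inj; rewrite (EFin_mean_sqr sL) EL.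
rewrite (_ : tau ^+ 4 = (tau ^+ 2) ^+ 2); last by rewrite -exprM.
have sZ := square_integrableZ (tau ^+ 2) sL.
rewrite -(mean_sqrZ _ sL) -lee_fin (EFin_mean_sqr sr) (EFin_mean_sqr sZ).
apply: ge0_le_integral => //.
- by move=> w _; rewrite lee_fin sqr_ge0.
- by apply/measurable_EFinP/measurable_funX; exact: sr.1.
- by apply/measurable_EFinP/measurable_funX/measurable_funM.
move=> xi _; rewrite lee_fin -[X in X <= _]real_normK ?num_real//.
rewrite -[X in _ <= X]real_normK ?num_real// ler_sqr ?nnegrE//.
rewrite normrM (ger0_norm (sqr_ge0 tau)) -tt.
rewrite -[X in X * _]real_normK ?num_real// normr_id real_normK ?num_real//.
exact: (taylor_rem_le (Q := Q) (tau := tau)).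
Qed.

Let EE_moments x i : Q x -> square_integrable P (EE x i) /\
  \int[P]_w (EE x i w ^+ 2) <= 4 * tau ^+ 2 * bias2.
Proof.
move=> Qx.
have ntau : `|tau| = tau by rewrite gtr0_norm.
have nmtau : `|- tau| = tau by rewrite normrN.
have [s1 m1] := rem_moments i Qx ntau.
have [s2 m2] := rem_moments i Qx nmtau.
have Qp : fd_enlargement Q tau (x + tau *: evec i).
  by exists x, i, tau; rewrite ntau.
have Qm : fd_enlargement Q tau (x - tau *: evec i).
  by exists x, i, (- tau); rewrite nmtau scaleNr.
have [s3 m3] := delta_moments Qp; have [s4 m4] := delta_moments Qm.
have t1 := square_integrable_law mxip lxip s1.
have t2 := square_integrable_law mxim lxim s2.
have t3 := square_integrable_law mxip lxip s3.
have t4 := square_integrable_law mxim lxim s4.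
have t12 := square_integrableB t1 t2; have t34 := square_integrableB t3 t4.
split; first exact: square_integrableD t12 t34.
apply: le_trans (mean_sqrD_le t12 t34) _.
have := mean_sqrB_le t1 t2; have := mean_sqrB_le t3 t4.
rewrite (mean_sqr_law mxip lxip s1) (mean_sqr_law mxim lxim s2).
rewrite (mean_sqr_law mxip lxip s3) (mean_sqr_law mxim lxim s4) => H1 H2.
have -> : 4 * tau ^+ 2 * bias2 = 8 * (tau ^+ 4 * L ^+ 2) + 8 * Delta ^+ 2.
  by rewrite /bias2; field; rewrite gt_eqF.
by move: H1 H2 m1 m2 m3 m4; lra.
Qed.

(** Both evaluations are expanded around [x], so the sampling errors of values and gradients are
    taken at a point of [Q], where their variances are controlled, although [x + tau e_i] may leave
    [Q]. *)
Let oracle_noiseE x i w : oracle_noise x i (xip w) (xim w) =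
  (2 * tau)^-1 * AA x w + 2^-1 * BB x i w + (2 * tau)^-1 * EE x i w.
Proof.
rewrite /oracle_noise /AA /BB /EE /grad_noise /taylor_rem scaleNr.
by field; rewrite gt_eqF.
Qed.

(** The gradient part stays attached to its coordinate: summed over [i] it costs [sigma_grad^2]
    once, whereas the other two terms are repeated [d] times. *)
Definition coord_variance x i : R := 3 * (sigma_f / tau) ^+ 2 + 3 * bias2 +
  3 * \int[pi]_xi (grad_noise x i xi ^+ 2).

Lemma sum_coord_variance_le x : Q x -> \sum_i coord_variance x i <=
  3 * (d%:R * (sigma_f / tau) ^+ 2 + sigma_grad ^+ 2 + d%:R * bias2).
Proof.
move=> Qx; rewrite big_split/= -mulr_sumr sumr_const card_ord.
have := sum_grad_noise_le Qx; rewrite -mulr_natl; nra.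
Qed.

(** [AA] and [BB] have mean zero, so the mean of the noise is that of [EE / (2 tau)] alone; the
    second moment collects all three parts, with the factor 3 of [mean_sqrD3_le]. *)
Lemma oracle_noise_moments x : Q x ->
  [/\ forall i, square_integrable P (fun w => oracle_noise x i (xip w) (xim w)),
      forall i, (\int[P]_w oracle_noise x i (xip w) (xim w)) ^+ 2 <= bias2 &
      forall i, \int[P]_w (oracle_noise x i (xip w) (xim w) ^+ 2) <=
        coord_variance x i].
Proof.
move=> Qx; have [sA mA vA] := AA_moments Qx.
have funE i : (fun w => oracle_noise x i (xip w) (xim w)) = (fun w =>
  (2 * tau)^-1 * AA x w + 2^-1 * BB x i w + (2 * tau)^-1 * EE x i w).
  by apply/funext => w; exact: oracle_noiseE.
have zA := square_integrableZ (2 * tau)^-1 sA.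
have zB i : square_integrable P (fun w => 2^-1 * BB x i w).
  by have [sB _ _] := BB_moments i Qx; exact: square_integrableZ.
have zE i : square_integrable P (fun w => (2 * tau)^-1 * EE x i w).
  by have [sE _] := EE_moments i Qx; exact: square_integrableZ.
have vE i : \int[P]_w (((2 * tau)^-1 * EE x i w) ^+ 2) <= bias2.
  have [sE vE] := EE_moments i Qx; rewrite mean_sqrZ//.
  rewrite exprVn ler_pdivrMl ?exprn_gt0 ?mulr_gt0//.
  by rewrite exprMn -(natrX _ 2 2).
split.
- move=> i; rewrite funE.
  exact: square_integrableD (square_integrableD zA (zB i)) (zE i).
- move=> i; have [sB mB _] := BB_moments i Qx; rewrite funE.
  rewrite (meanD (square_integrableD zA (zB i)) (zE i)) (meanD zA (zB i)).
  rewrite (meanZ _ sA) (meanZ _ sB) mA mB !mulr0 !add0r.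
  exact: le_trans (sqr_mean_le (zE i)) (vE i).
move=> i; have [sB _ vB] := BB_moments i Qx.
rewrite (_ : \int[P]_w _ = \int[P]_w (((2 * tau)^-1 * AA x w + 2^-1 * BB x i w
    + (2 * tau)^-1 * EE x i w) ^+ 2)); last first.
  by apply: eq_Rintegral => w _; rewrite oracle_noiseE.
apply: le_trans (mean_sqrD3_le zA (zB i) (zE i)) _.
have vA' : \int[P]_w (((2 * tau)^-1 * AA x w) ^+ 2) <= (sigma_f / tau) ^+ 2.
  rewrite (mean_sqrZ _ sA) exprVn ler_pdivrMl ?exprn_gt0 ?mulr_gt0//.
  apply: le_trans vA _; rewrite le_eqVlt; apply/orP; left; apply/eqP.
  by field; rewrite gt_eqF.
have vB' : \int[P]_w ((2^-1 * BB x i w) ^+ 2) <=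
  \int[pi]_xi (grad_noise x i xi ^+ 2).
  rewrite (mean_sqrZ _ sB); lra.
by have := vE i; rewrite /coord_variance; lra.
Qed.

End OracleNoise.

(** * Integrating out a sample that is independent of the past *)

Section Restriction.
Local Open Scope ereal_scope.
Context d (T : measurableType d) (R : realType) (mu : {measure set T ->
  \bar R}).
Context (J : set T) (mJ : measurable J).

Lemma ge0_integral_mrestr (g : T -> \bar R) : measurable_fun setT g ->
  (forall w, 0 <= g w) -> \int[mrestr mu mJ]_w g w = \int[mu]_(w in J) g w.
Proof.
move=> mg g0; have mJC := measurableC mJ.
rewrite -(setUv J) ge0_integral_setU//; first last.
- exact/disj_set2P/setICr.
- exact: measurable_funTS.
rewrite [X in _ + X]null_set_integral//; first last.
- by rewrite /= /mrestr setICl measure0.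
- exact: measurable_funTS.
rewrite adde0; apply: eq_measure_integral => A mA AJ.
by rewrite /= /mrestr setIidl.
Qed.

End Restriction.

Section Freezing.
Local Open Scope ereal_scope.
Context (R : realType) (dO dX dY : measure_display)
  (Omega : measurableType dO) (Y : measurableType dY) (Xi : measurableType dX).
Context (P : probability Omega R) (G : set_system Omega).
Hypothesis sG : sigma_algebra setT G.
Hypothesis mG : G `<=` measurable.

(** Both sides are finite measures in [C] that agree on rectangles. Rectangles are stable under
    intersection and generate the product sigma-algebra, so the measures coincide. *)
Lemma rectangles_independent (X X' : Omega -> Xi) (J : set Omega) (p : R) A :
  measurable_fun setT X -> measurable_fun setT X' -> measurable J ->
  measurable A -> (0 <= p)%R ->
  (forall B B', measurable B -> measurable B' ->
    P (A `&` (J `&` (X @^-1` B `&` X' @^-1` B'))) =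
    P A * (p%:E * P (X @^-1` B `&` X' @^-1` B'))) ->
  forall C, measurable C ->
    P (A `&` (J `&` (fun w => (X w, X' w)) @^-1` C)) =
    P A * (p%:E * P ((fun w => (X w, X' w)) @^-1` C)).
Proof.
move=> mX mX' mJ mA p0 H C mC.
pose Z w := (X w, X' w).
have mZ : measurable_fun setT Z by exact: measurable_fun_pair.
have mAJ := measurableI _ _ mA mJ.
pose c := (fine (P A) * p)%R;
  have c0 : (0 <= c)%R by rewrite mulr_ge0// fine_ge0.
pose m1 : {measure set (Xi * Xi) -> \bar R} := pushforward (mrestr P mAJ) Z.
pose m2 : {measure set (Xi * Xi) ->
  \bar R} := mscale (NngNum c0) (pushforward P Z).
have PA : (fine (P A))%:E = P A by rewrite fineK// fin_num_measure.
have E1 D : m1 mZ D = P (A `&` (J `&` Z @^-1` D)).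
  by rewrite /m1 /= /pushforward /mrestr setIC setIA.
have E2 D : m2 mZ D = P A * (p%:E * P (Z @^-1` D)).
  by rewrite /m2 /= /mscale /= /pushforward EFinM PA muleA.
rewrite -E1 -E2; apply: (measure_unique
  [set D | exists B B', [/\ measurable B, measurable B' & D = B `*` B']]
  (fun=> setT)) => //.
- rewrite measurable_prod_measurableType; congr (<<s _ >>).
  rewrite predeqE => D; split=> [[B mB [B' mB' <-]]|[B [B' [mB mB' ->]]]].
    by exists B, B'.
  by exists B => //; exists B'.
- move=> _ _ [B1 [B1' [mB1 mB1' ->]]] [B2 [B2' [mB2 mB2' ->]]].
  rewrite -setXI; exists (B1 `&` B2), (B1' `&` B2').
  by split => //; exact: measurableI.
- by move=> _; exists setT, setT; rewrite setXTT.
- by rewrite bigcup_const//; exists 0%N.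
- by move=> _ [B [B' [mB mB' ->]]]; rewrite E1 E2; exact: H.
- by move=> _; rewrite E1 ltey_eq fin_num_measure//; apply: measurableI => //;
    apply: measurableI => //; rewrite preimage_setT.
Qed.

(** [Omega] with only the events of [G]: measurability with respect to [G] becomes ordinary
    measurability on [T1], and Tonelli applies on [T1 * Y]. *)
Let T1 : measurableType _ := g_sigma_algebraType G.

Lemma measurable_sub_sigma (d' : measure_display) (T' : measurableType d')
    (X : Omega -> T') :
  measurable_fun setT (X : T1 -> T') -> measurable_fun setT X.
Proof.
move=> mX _ B mB; have := mX measurableT B mB.
by rewrite (measurable_g_measurableTypeE sG) => /mG.
Qed.

Lemma measurable_id_sub : measurable_fun setT (id : Omega -> T1).
Proof. by apply: measurable_sub_sigma; exact: measurable_id. Qed.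

Lemma measurable_partial_integral (Z : Omega -> Y) (Phi : T1 * Y -> \bar R) :
  measurable_fun setT Z -> measurable_fun setT Phi -> (forall q, 0 <= Phi q) ->
  measurable_fun setT (fun w : Omega => \int[P]_w' Phi (w, Z w')).
Proof.
move=> mZ mPhi Phi0; apply: measurable_sub_sigma.
pose ZT : {mfun Omega >-> Y} := HB.pack Z (isMeasurableFun.Build _ _ _ _ Z mZ).
have := measurable_fun_fubini_tonelli_F (m2 := distribution P ZT) Phi mPhi Phi0.
congr measurable_fun; apply/funext => w.
by rewrite /fubini_F ge0_integral_distribution//; exact: measurable_fun_pair2.
Qed.

(* Stands in for conditioning on G: since Z is independent of G, its law can be
   integrated out while the G-measurable argument is held fixed. *)
Lemma independent_integral (Z : Omega -> Y) (J : set Omega) (p : R)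
    (Phi : T1 * Y -> \bar R) :
  measurable_fun setT Z -> measurable J -> (0 < p)%R ->
  (forall A C, G A -> measurable C ->
    P (A `&` (J `&` Z @^-1` C)) = P A * (p%:E * P (Z @^-1` C))) ->
  measurable_fun setT Phi -> (forall q, 0 <= Phi q) ->
  \int[P]_(w in J) Phi (w, Z w) =
  p%:E * \int[P]_w (\int[P]_w' Phi (w, Z w')).
Proof.
move=> mZ mJ p0 H mPhi Phi0.
pose idT : {mfun Omega >-> T1} := HB.pack (id : Omega -> T1)
  (isMeasurableFun.Build _ _ _ _ (id : Omega -> T1) measurable_id_sub).
pose ZT : {mfun Omega >-> Y} := HB.pack Z (isMeasurableFun.Build _ _ _ _ Z mZ).
pose m1 := distribution P idT; pose m2 := distribution P ZT.
pose phi w : T1 * Y := (w, Z w).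
have mphi : measurable_fun setT phi.
  by apply: measurable_fun_pair => //; exact: measurable_id_sub.
have p0' : (0 <= p^-1)%R by rewrite invr_ge0 ltW.
(* The law of [(w, Z w)] under [P] restricted to [J], divided by [p]. By hypothesis it agrees with
   the product of the marginals on rectangles, hence everywhere, and the claim becomes Tonelli for
   that product. *)
pose m' : {measure set (T1 * Y) -> \bar R} :=
  mscale (NngNum p0') (pushforward (mrestr P mJ) phi).
have m'E : forall D, measurable D -> (m1 \x m2)%E D = m' mphi D.
  apply: product_measure_unique => A C mA mC.
  have GA : G A by rewrite -(measurable_g_measurableTypeE sG).
  rewrite /m' /= /mscale /= /pushforward /mrestr.
  rewrite (_ : _ `&` J = A `&` (J `&` Z @^-1` C)); last first.
    by apply/seteqP; split => w /=; rewrite /phi/=; tauto.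
  rewrite H// muleCA [X in _ * X]muleA -EFinM mulVf ?gt_eqF// mul1e.
  by rewrite /m1 /m2 /distribution /pushforward /=.
have intE : \int[m1 \x m2]_q Phi q = p^-1%:E * \int[P]_(w in J) Phi (w, Z w).
  rewrite (eq_measure_integral (m' mphi)); last by move=> A mA _; exact: m'E.
  rewrite ge0_integral_mscale//= ge0_integral_pushforward//=.
  by rewrite preimage_setT ge0_integral_mrestr//; exact: measurableT_comp.
have mF : measurable_fun setT (fubini_F m2 Phi)
  by exact: measurable_fun_fubini_tonelli_F.
have := fubini_tonelli1 (m1 := distribution P idT) (m2 := distribution P ZT) Phi mPhi Phi0.
rewrite -/m1 -/m2 intE ge0_integral_distribution//; last first.
  by move=> x; exact: integral_ge0.
move=> E; rewrite -[LHS]mul1e -(mulfV (lt0r_neq0 p0)) EFinM -muleA E.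
congr (_ * _); apply: eq_integral => w _ /=.
by rewrite /fubini_F ge0_integral_distribution//; exact: measurable_fun_pair2.
Qed.
End Freezing.

(** * One-step bounds conditional on the past *)

Section ConditionalBound.
Local Open Scope ereal_scope.
Context (R : realType) (d : nat) (dO dX : measure_display)
  (Omega : measurableType dO) (Xi : measurableType dX).
Context (P : probability Omega R) (pi : probability Xi R) (fb : feedback)
  (Fk : nat -> set_system Omega) (xi0p xi0m : 'I_d -> Omega -> Xi)
  (idx : nat -> Omega -> 'I_d) (xip xim : nat -> Omega -> Xi).
Hypothesis d0 : (0 < d)%N.
Hypothesis S : jaguar_sampling fb P pi Fk xi0p xi0m idx xip xim.

Lemma measurable_sample k :
  measurable_fun setT (xip k) /\ measurable_fun setT (xim k).
Proof.
have [sp sm] := sample_adapted S k; split=> _ B mB; rewrite setTI.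
  exact: (filtration_measurable S (sp _ mB)).
exact: (filtration_measurable S (sm _ mB)).
Qed.

Lemma measurable_index k i : measurable (idx k @^-1` [set i]).
Proof. exact: (filtration_measurable S) (index_adapted S k i). Qed.

(** Plays the role of the tower property: [Psi] dominates the conditional mean of [Phi] given
    [Fk k], computed pathwise by averaging the index with weight [1/d] and integrating the sample
    pair only. Nonnegativity of [Phi] makes Tonelli available without an integrability check. *)
Lemma conditional_bound k
    (Phi : 'I_d -> g_sigma_algebraType (Fk k) -> Xi -> Xi -> R) (Psi : Omega ->
      R) :
  (forall i, measurable_fun setT
    (fun q : g_sigma_algebraType (Fk k) * (Xi * Xi) =>
      Phi i q.1 q.2.1 q.2.2)) ->
  (forall i w xp xm, 0 <= Phi i w xp xm)%R ->
  measurable_fun setT Psi -> (forall w, 0 <= Psi w)%R ->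
  (forall w, \sum_(i < d) (d%:R^-1)%:E *
     \int[P]_w' (Phi i w (xip k w') (xim k w'))%:E <= (Psi w)%:E) ->
  \int[P]_w (Phi (idx k w) w (xip k w) (xim k w))%:E <= \int[P]_w (Psi w)%:E.
Proof.
move=> mPhi Phi0 mPsi Psi0 H.
have [mp mm] := measurable_sample k.
pose J i := idx k @^-1` [set i].
pose Z w := (xip k w, xim k w).
have mZ : measurable_fun setT Z by exact: measurable_fun_pair.
pose g i (w : Omega) := (Phi i w (xip k w) (xim k w))%:E.
have sF := filtration_sigma S k;
  have mF : Fk k `<=` measurable by exact: (filtration_measurable S).
have mPhiE i : measurable_fun setT (fun q : g_sigma_algebraType (Fk k) * (Xi * Xi) =>
    (Phi i q.1 q.2.1 q.2.2)%:E) by exact/measurable_EFinP.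
have mg i : measurable_fun setT (g i).
  pose phi w : g_sigma_algebraType (Fk k) * (Xi * Xi) := (w, Z w).
  have mw : measurable_fun setT phi.
    by apply: measurable_fun_pair => //; exact: measurable_id_sub.
  exact: (measurableT_comp (mPhiE i) mw).
(* [Omega] is cut along the value of the random index: at each [w] exactly one of the restricted
   integrands is active. On each piece the index is a constant. *)
have -> : \int[P]_w (Phi (idx k w) w (xip k w) (xim k w))%:E =
    \sum_(i < d) \int[P]_(w in J i) g i w.
  under [RHS]eq_bigr do rewrite integral_mkcond.
  rewrite -ge0_integral_sum//; first last.
  - by move=> i w _; apply: erestrict_ge0 => x _; rewrite lee_fin.
  - move=> i; apply/(measurable_restrictT _ (measurable_index k i)).
    exact: measurable_funTS.
  apply: eq_integral => w _; rewrite (bigD1 (idx k w))//= big1 ?adde0.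
    by rewrite patchE mem_set.
  by move=> i iw; rewrite patchE memNset// /J/= => E; rewrite E eqxx in iw.
have dinv0 : (0 < d%:R^-1 :> R)%R by rewrite invr_gt0 ltr0n.
under eq_bigr => i _.
  rewrite (independent_integral sF mF (Z := Z) (J := J i) (p := d%:R^-1)
    (Phi := fun q => (Phi i q.1 q.2.1 q.2.2)%:E))//; first last.
  - by move=> q; rewrite lee_fin.
  - move=> A C GA mC; apply: rectangles_independent => //.
    + exact: measurable_index.
    + exact: mF.
    + by move=> B B' mB mB'; rewrite (step_independent S)// (index_uniform S).
  - exact: measurable_index.
  over.
have mI i : measurable_fun setT (fun w : Omega =>
    \int[P]_w' (Phi i w (xip k w') (xim k w'))%:E).
  apply: (measurable_partial_integral P sF mF mZ (mPhiE i)) => q.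
  by rewrite lee_fin.
have I0 i (w : Omega) : 0 <= \int[P]_w' (Phi i w (xip k w') (xim k w'))%:E.
  by apply: integral_ge0 => w' _; rewrite lee_fin.
rewrite /=; under eq_bigr => i _.
  rewrite -ge0_integralZl//.
  over.
rewrite -ge0_integral_sum//; last 2 first.
- by move=> i; exact: measurable_funeM.
- by move=> i w _; rewrite mule_ge0 ?lee_fin// ltW.
apply: ge0_le_integral => //.
- by move=> w _; apply: sume_ge0 => i _; rewrite mule_ge0 ?lee_fin// ltW.
- by apply: emeasurable_sum => i; exact: measurable_funeM.
exact/measurable_EFinP.
Qed.

End ConditionalBound.

(** * Measurability of vector-valued maps, of the mean and of its gradient *)

Section BorelVectors.
Context (R : realType) (d : nat).

Lemma measurable_coord (i : 'I_d) :
  measurable_fun setT (fun x : borel_rV R d => (x : 'rV[R]_d) 0 i).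
Proof.
move=> _ Y mY; rewrite setTI; apply: sub_sigma_algebra;
  apply: sub_sigma_algebra => /=.
rewrite -bigcup_seq/=; exists i => /=; first by rewrite mem_index_enum.
by exists Y => //; rewrite setTI.
Qed.

Lemma measurable_fun_rV (dT : measure_display) (T : measurableType dT)
    (h : T -> borel_rV R d) :
  (forall i, measurable_fun setT (fun t => (h t : 'rV[R]_d) 0 i)) ->
  measurable_fun setT h.
Proof.
move=> mh; apply: (@measurability _ _ _ (borel_rV R d) setT h
  (g_sigma_preimage (fun (i : 'I_d) (x : 'rV[R]_d) => x 0 i))) => //.
move=> _ [B gB <-]; rewrite setTI.
pose S := [set B : set (borel_rV R d) | measurable (h @^-1` B)].
suff : g_sigma_preimage (fun (i : 'I_d) (x : 'rV[R]_d) => x 0 i) `<=` S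
  by apply.
apply: smallest_sub => /=.
  split; rewrite /S/=.
  - by rewrite preimage_set0.
  - by move=> A mA; rewrite setTD preimage_setC; exact: measurableC.
  - by move=> A mA; rewrite preimage_bigcup; exact: bigcupT_measurable.
move=> C; rewrite -bigcup_seq/= => -[i _ [Y mY <-]]; rewrite /S/= setTI.
by rewrite -[X in measurable X]setTI; exact: mh.
Qed.

Lemma measurable_translation (v : 'rV[R]_d) :
  measurable_fun setT (fun x : borel_rV R d =>
    (x : 'rV[R]_d) + v : borel_rV R d).
Proof.
apply: measurable_fun_rV => i.
rewrite (_ : (fun t => _) = (fun x : borel_rV R d =>
  (x : 'rV[R]_d) 0 i + v 0 i)).
  by apply: measurable_funD => //; exact: measurable_coord.
by apply/funext => x; rewrite mxE.
Qed.

Context (dX : measure_display) (Xi : measurableType dX) (pi : probability Xi R)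
  (f : 'rV[R]_d -> Xi -> R).
Hypothesis mf : jointly_measurable f.

Lemma measurable_mean : measurable_fun setT (mean pi f : borel_rV R d -> R).
Proof.
pose g (p : borel_rV R d * Xi) := (f p.1 p.2)%:E.
have mg : measurable_fun setT g by exact/measurable_EFinP.
(* [f] has no sign, so Tonelli is applied to its positive and negative parts and the results are
   subtracted. *)
have mpos := measurable_fun_fubini_tonelli_F (m2 := pi) (g^\+)%E
  (measurable_funepos mg) (funepos_ge0 g).
have mneg := measurable_fun_fubini_tonelli_F (m2 := pi) (g^\-)%E
  (measurable_funeneg mg) (funeneg_ge0 g).
have := measurableT_comp (fine_measurable measurableT) (emeasurable_funB mpos mneg).
congr measurable_fun; apply/funext => x /=.
rewrite meanE /Rintegral [in RHS]integralE /fubini_F.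
by congr (fine (_ - _)); apply: eq_integral => y _; rewrite ?funeposE ?funenegE.
Qed.

Hypothesis dm : forall x, differentiable (mean pi f : 'rV[R]_d -> R^o) x.

Lemma measurable_grad_mean i :
  measurable_fun setT (fun x : borel_rV R d => grad (mean pi f) x 0 i).
Proof.
apply: (measurable_fun_cvg (h := fun n (x : borel_rV R d) =>
  n.+1%:R * (mean pi f ((x : 'rV[R]_d) + n.+1%:R^-1 *: evec i) - mean pi f x))).
  move=> n; apply: measurable_funM => //; apply: measurable_funB; last first.
    exact: measurable_mean.
  exact: measurableT_comp measurable_mean (measurable_translation _).
by move=> x _; exact: grad_seq_cvg.
Qed.

End BorelVectors.

(** * Averaging a coordinate update over the index *)

Section CoordinateUpdate.
Context (R : realType) (d : nat).
Implicit Types (a u v h : 'rV[R]_d).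

Lemma enormD_evec v (t : R) i :
  enorm (v + t *: evec i) ^+ 2 = enorm v ^+ 2 + 2 * t * v 0 i + t ^+ 2.
Proof.
rewrite !enorm_sqr_dot !(dotDl, dotDr) !(dotZl, dotZr) !dot_evec.
rewrite (dotC (evec i)) dot_evec evecE eqxx /=; ring.
Qed.

(** Refreshing entry [i] replaces the error [a_i] by noise of second moment [nu i]. The average of
    [a_i^2] over [i] is [|a|^2 / d], which is the contraction [1 - 1/d]. *)
Lemma mean_memory_update a (nu : 'I_d -> R) (V : R) : (0 < d)%N ->
  \sum_i nu i <= V ->
  \sum_(i < d) d%:R^-1 * (enorm a ^+ 2 - a 0 i ^+ 2 + nu i) <=
    (1 - d%:R^-1) * enorm a ^+ 2 + V / d%:R.
Proof.
move=> d0 nuV; have d0' : (0 : R) < d%:R by rewrite ltr0n.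
rewrite -mulr_sumr !big_split/= sumrN -enorm_sqr sumr_const card_ord.
rewrite -(mulr_natl (enorm a ^+ 2)); set e := enorm a ^+ 2.
have -> : (1 - d%:R^-1) * e + V / d%:R = d%:R^-1 * (d%:R * e - e + V).
  by field; rewrite gt_eqF.
by rewrite ler_wpM2l ?invr_ge0 ?(ltW d0')// lerD2l.
Qed.

(** [beta] and [nu] bound the first and second moments of the noise. Since
    [c + eta a = (1 - eta) u], the memory error cancels at first order in [eta] and survives only
    with [eta^2]. The bias meets [u] in [2 eta (1 - eta) u beta], at most
    [eta (1 - eta) (u^2 / 2 + 2 beta^2)]; this turns [(1 - eta)^2] into [(1 - eta) (1 - eta/2)] and
    costs at most [2 eta b2]. *)
Lemma average_update_coord (D eta a u beta nu b2 : R) : 1 <= D ->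
  0 <= eta -> eta <= 1 -> beta ^+ 2 <= nu -> beta ^+ 2 <= b2 ->
  let c := (1 - eta) * u - eta * a in
  c ^+ 2 + 2 * eta * a * c + eta ^+ 2 * D * a ^+ 2
    + (2 * eta * c + 2 * eta ^+ 2 * D * a) * beta + eta ^+ 2 * D * nu <=
  (1 - eta) * (1 - eta / 2) * u ^+ 2 + 2 * eta * b2
    + eta ^+ 2 * (2 * D * a ^+ 2 + 2 * D * nu).
Proof.
move=> D1 e0 e1 bnu bb /=.
have e10 : 0 <= 1 - eta by rewrite subr_ge0.
have e2 := sqr_ge0 eta; have D10 : 0 <= D - 1 by rewrite subr_ge0.
have D0 : 0 <= D by exact: le_trans D1.
have nu0 : 0 <= nu - beta ^+ 2 by rewrite subr_ge0.
have b20 : 0 <= b2 - beta ^+ 2 by rewrite subr_ge0.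
have s1 := mulr_ge0 (mulr_ge0 e0 e10) (sqr_ge0 (u - 2 * beta)).
have s2 := mulr_ge0 (mulr_ge0 e2 D10) (sqr_ge0 (a - beta)).
have s3 := mulr_ge0 (mulr_ge0 e2 D10) nu0.
have s4 := mulr_ge0 (mulr_ge0 e0 e10) b20.
have s5 := mulr_ge0 e2 (le_trans (sqr_ge0 beta) bb).
have s6 := mulr_ge0 e2 (le_trans (sqr_ge0 beta) bnu).
have s7 := mulr_ge0 (mulr_ge0 e2 D0) (sqr_ge0 a).
have s8 := mulr_ge0 e2 (sqr_ge0 a).
nra.
Qed.

Lemma mean_average_update (eta b2 V : R) a u (beta nu : 'I_d ->
  R) : (0 < d)%N ->
  0 <= eta -> eta <= 1 -> (forall i, beta i ^+ 2 <= nu i) ->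
  (forall i, beta i ^+ 2 <= b2) -> \sum_i nu i <= V ->
  forall c, c = (1 - eta) *: u - eta *: a ->
  \sum_(i < d) d%:R^-1 * (enorm c ^+ 2 + 2 * (eta * d%:R * a 0 i) * c 0 i
      + (eta * d%:R * a 0 i) ^+ 2
    + (2 * (eta * d%:R) * c 0 i + 2 * (eta * d%:R) ^+ 2 * a 0 i) * beta i
    + (eta * d%:R) ^+ 2 * nu i) <=
  (1 - eta) * (1 - eta / 2) * enorm u ^+ 2 + 2 * eta * (d%:R * b2)
    + eta ^+ 2 * (2 * d%:R * enorm a ^+ 2 + 2 * d%:R * V).
Proof.
move=> d0 e0 e1 bnu bb nuV c cE.
have d0' : (0 : R) < d%:R by rewrite ltr0n.
have d1 : (1 : R) <= d%:R by rewrite ler1n.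
apply: (@le_trans _ _ (\sum_(i < d) ((1 - eta) * (1 - eta / 2) * u 0 i ^+ 2
    + 2 * eta * b2 + eta ^+ 2 * (2 * d%:R * a 0 i ^+ 2 + 2 * d%:R * nu i))));
      last first.
  rewrite !big_split/= -!mulr_sumr !big_split/= -!mulr_sumr -!enorm_sqr.
  rewrite sumr_const card_ord -(mulr_natl b2).
  by rewrite lerD2l ler_wpM2l ?sqr_ge0// lerD2l ler_wpM2l// mulr_ge0// ltW.
have -> : \sum_(i < d) d%:R^-1 * (enorm c ^+ 2 + 2 * (eta * d%:R * a 0 i) * c 0 i
      + (eta * d%:R * a 0 i) ^+ 2
    + (2 * (eta * d%:R) * c 0 i + 2 * (eta * d%:R) ^+ 2 * a 0 i) * beta i
    + (eta * d%:R) ^+ 2 * nu i) =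
  \sum_(i < d) (c 0 i ^+ 2 + 2 * eta * a 0 i * c 0 i + eta ^+ 2 * d%:R * a 0 i ^+ 2
    + (2 * eta * c 0 i + 2 * eta ^+ 2 * d%:R * a 0 i) * beta i
    + eta ^+ 2 * d%:R * nu i).
  (* The term [enorm c ^+ 2 / d], equal for all [i], sums to [enorm c ^+ 2] and is then
     redistributed as one [c_i^2] per coordinate, so that the inequality can be proved
     coordinatewise. *)
  apply: (@eq_trans _ _ (\sum_(i < d) (d%:R^-1 * enorm c ^+ 2 +
    (2 * eta * a 0 i * c 0 i + eta ^+ 2 * d%:R * a 0 i ^+ 2
    + (2 * eta * c 0 i + 2 * eta ^+ 2 * d%:R * a 0 i) * beta i
    + eta ^+ 2 * d%:R * nu i)))).
    by apply: eq_bigr => i _; field; rewrite gt_eqF.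
  rewrite big_split/= sumr_const card_ord -(mulr_natl (d%:R^-1 * _)) mulVKf ?gt_eqF//.
  by rewrite enorm_sqr -big_split/=; apply: eq_bigr => i _; rewrite !addrA.
apply: ler_sum => i _.
have -> : c 0 i = (1 - eta) * u 0 i - eta * a 0 i by rewrite cE !mxE.
exact: average_update_coord.
Qed.

End CoordinateUpdate.

(** * Adaptedness of the iterates and integration of affine bounds *)

Lemma measurable_fun_index (R : realType) (dT : measure_display)
    (T : measurableType dT) (d : nat) (idx : T -> 'I_d) (g : 'I_d -> T -> R) :
  (forall i, measurable (idx @^-1` [set i])) ->
  (forall i, measurable_fun setT (g i)) -> measurable_fun setT (fun w =>
    g (idx w) w).
Proof.
move=> mi mg.
have -> : (fun w => g (idx w) w) =
    (fun w => \sum_(i < d) g i w * \1_(idx @^-1` [set i]) w).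
  apply/funext => w; rewrite (bigD1 (idx w))//= indicE mem_set// mulr1.
  rewrite big1 ?addr0// => i iw; rewrite indicE memNset ?mulr0// => /= E.
  by rewrite E eqxx in iw.
by apply: measurable_sum => i; apply: measurable_funM => //;
  exact: measurable_indic.
Qed.

Lemma measurable_oracle (R : realType) (d : nat) (dT dX : measure_display)
    (T : measurableType dT) (Xi : measurableType dX) (F : 'rV[R]_d -> Xi -> R)
    (v : T -> 'rV[R]_d) (Y : T -> Xi) (u : 'rV[R]_d) :
  jointly_measurable F ->
  (forall j, measurable_fun setT (fun t => v t 0 j)) -> measurable_fun setT Y ->
  measurable_fun setT (fun t => F (v t + u) (Y t)).
Proof.
move=> mF mv mY.
have mvb : measurable_fun setT (fun t => v t + u : borel_rV R d).
  apply: measurable_fun_rV => j.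
  rewrite (_ : (fun t => _) = (fun t => v t 0 j + u 0 j)).
    by apply: measurable_funD.
  by apply/funext => t; rewrite mxE.
exact: (measurableT_comp mF (measurable_fun_pair mvb mY)).
Qed.

Section Iterates.
Context {R : realType} {d : nat} {dO dX : measure_display}
  {Omega : measurableType dO} {Xi : measurableType dX}.
Context (P : probability Omega R) (pi : probability Xi R) (fb : feedback).
Context (Q : set 'rV[R]_d) (F : 'rV[R]_d -> Xi -> R) (tau : R)
  (gamma eta : nat -> R) (Fk : nat -> set_system Omega)
  (xi0p xi0m : 'I_d -> Omega -> Xi)
  (idx : nat -> Omega -> 'I_d) (xip xim : nat -> Omega -> Xi)
  (x0 : 'rV[R]_d) (x h g s : nat -> Omega -> 'rV[R]_d).
Hypothesis mF : jointly_measurable F.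
Hypothesis S : jaguar_sampling fb P pi Fk xi0p xi0m idx xip xim.
Hypothesis A : fw_jaguar Q F tau gamma eta Fk xi0p xi0m idx xip xim x0 x h g s.

Local Notation past k := (g_sigma_algebraType (Fk k)).

Lemma measurable_past (k : nat) (dT : measure_display) (T : measurableType dT)
    (X : Omega -> T) :
  measurable_wrt (Fk k) X -> measurable_fun setT (X : past k -> T).
Proof. by move=> mX _ B mB; rewrite setTI; apply: sub_sigma_algebra;
  exact: mX. Qed.

Lemma measurable_past_le (k : nat) (dT : measure_display) (T : measurableType dT)
    (X : Omega -> T) :
  measurable_fun setT (X : past k -> T) -> measurable_fun setT (X : past k.+1 ->
    T).
Proof.
move=> mX; apply: measurable_past => B mB; apply: (filtration_ndecr S).
have := mX measurableT B mB.
by rewrite setTI (measurable_g_measurableTypeE (filtration_sigma S k)).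
Qed.

Definition adapted (X : nat -> Omega -> 'rV[R]_d) k :=
  forall j, measurable_fun setT (fun w : past k => X k w 0 j).

Lemma measurable_coord_diff (dT : measure_display) (T : measurableType dT)
    (v : T -> 'rV[R]_d) (Y Y' : T -> Xi) i j :
  (forall j, measurable_fun setT (fun t => v t 0 j)) ->
  measurable_fun setT Y -> measurable_fun setT Y' ->
  measurable_fun setT (fun t => (coord_diff F tau i (v t) (Y t) (Y' t)) 0 j).
Proof.
move=> mv mY mY'; rewrite (_ : (fun t => _) = (fun t =>
  (F (v t + tau *: evec i) (Y t) - F (v t - tau *: evec i) (Y' t)) / (2 * tau)
  * (evec i : 'rV[R]_d) 0 j)); last by apply/funext => t; rewrite mxE.
apply: measurable_funM => //; apply: measurable_funM => //.
by apply: measurable_funB; exact: measurable_oracle.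
Qed.

(** This is what lets [x k], [h k] and [g k] be frozen while the data of step [k] are integrated
    out. In the induction the random coordinate is treated by [measurable_fun_index], and [s k] is
    measurable by the adaptedness required of the selection. *)
Lemma iterates_adapted k : [/\ adapted x k, adapted h k & adapted g k].
Proof.
elim: k => [|k [ax ah ag]].
  have ah : adapted h 0.
    move=> j; under eq_fun do rewrite (init_h A) summxE.
    apply: measurable_sum => i; have [mp mm] := init_adapted S i.
    by apply: measurable_coord_diff => //; exact: measurable_past.
  split=> // j; last by under eq_fun do rewrite (init_g A); exact: ah.
  by under eq_fun do rewrite (init_x A); exact: measurable_cst.
have mi i : measurable (idx k @^-1` [set i] : set (past k.+1)).
  by apply: sub_sigma_algebra; exact: (index_adapted S k i).
have [mp mm] := sample_adapted S k.
have mp' := measurable_past mp; have mm' := measurable_past mm.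
have {}ax j := measurable_past_le (ax j).
have {}ah j := measurable_past_le (ah j).
have {}ag j := measurable_past_le (ag j).
have mc i j : measurable_fun setT (fun w : past k.+1 =>
    (coord_diff F tau i (x k w) (xip k w) (xim k w)) 0 j).
  exact: measurable_coord_diff.
split=> j.
- rewrite (_ : (fun w => _) = (fun w : past k.+1 =>
    x k w 0 j + gamma k * (s k w 0 j - x k w 0 j))).
    apply: measurable_funD => //; apply: measurable_funM => //.
    apply: measurable_funB => //; exact: measurable_past (s_adapted A k j).
  by apply/funext => w; rewrite (step_x A) !mxE.
- pose G i (w : past k.+1) := h k w 0 j - h k w 0 i * (evec i : 'rV[R]_d) 0 j
    + (coord_diff F tau i (x k w) (xip k w) (xim k w)) 0 j.
  rewrite (_ : (fun w => _) = (fun w : past k.+1 => G (idx k w) w)).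
    apply: (measurable_fun_index (g := G)) => // i;
      apply: measurable_funD => //.
    by apply: measurable_funB => //; apply: measurable_funM.
  by apply/funext => w; rewrite (step_h A) dot_evec mxE; congr (_ + _);
    rewrite !mxE.
pose G i (w : past k.+1) := (1 - eta k) * g k w 0 j + eta k *
     (h k w 0 j - d%:R * h k w 0 i * (evec i : 'rV[R]_d) 0 j
     + d%:R * (coord_diff F tau i (x k w) (xip k w) (xim k w)) 0 j).
rewrite (_ : (fun w => _) = (fun w : past k.+1 => G (idx k w) w)).
  apply: (measurable_fun_index (g := G)) => // i; apply: measurable_funD => //.
    by apply: measurable_funM.
  apply: measurable_funM => //; apply: measurable_funD => //; last first.
    by apply: measurable_funM.
  apply: measurable_funB => //; apply: measurable_funM => //.
  by apply: measurable_funM.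
apply/funext => w; rewrite (step_g A) /jaguar_rho dot_evec mxE.
by congr (_ + _); rewrite !mxE.
Qed.

End Iterates.

(** Everything is nonnegative and the integrals are extended, so no integrability of [X] is
    presupposed: finite bounds for [Y] and [Z] produce one for [X]. *)
Lemma integral_le_affine (R : realType) (dT : measure_display)
    (T : measurableType dT) (P : probability T R) (X Y Z : T -> R)
    (a b c A B : R) :
  measurable_fun setT X -> measurable_fun setT Y -> measurable_fun setT Z ->
  (forall w, 0 <= X w) -> (forall w, 0 <= Y w) -> (forall w, 0 <= Z w) ->
  0 <= a -> 0 <= b -> 0 <= c ->
  (forall w, X w <= a * Y w + b * Z w + c) ->
  (\int[P]_w (Y w)%:E <= A%:E)%E -> (\int[P]_w (Z w)%:E <= B%:E)%E ->
  (\int[P]_w (X w)%:E <= (a * A + b * B + c)%:E)%E.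
Proof.
move=> mX mY mZ X0 Y0 Z0 a0 b0 c0 H HY HZ.
have mYE : measurable_fun setT (fun w => (Y w)%:E) by exact/measurable_EFinP.
have mZE : measurable_fun setT (fun w => (Z w)%:E) by exact/measurable_EFinP.
apply: (@le_trans _ _ (\int[P]_w (a%:E * (Y w)%:E + b%:E * (Z w)%:E + c%:E)))%E.
  have mXE : measurable_fun setT (fun w => (X w)%:E) by exact/measurable_EFinP.
  apply: ge0_le_integral => //.
  - by move=> w _; rewrite lee_fin.
  - by apply: emeasurable_funD => //; apply: emeasurable_funD;
      exact: measurable_funeM.
  - by move=> w _; exact: H.
rewrite ge0_integralD//; first last.
- by apply: emeasurable_funD; exact: measurable_funeM.
- by move=> w _; rewrite adde_ge0// mule_ge0// lee_fin.
rewrite ge0_integralD//; first last.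
- exact: measurable_funeM.
- by move=> w _; rewrite mule_ge0// lee_fin.
- exact: measurable_funeM.
- by move=> w _; rewrite mule_ge0// lee_fin.
rewrite !ge0_integralZl//; try by move=> w _; rewrite lee_fin.
rewrite integral_cst// [X in (c%:E * X)%E]probability_setT mule1 !EFinD !EFinM.
by rewrite leeD2r// leeD// lee_pmul// ?lee_fin//; apply: integral_ge0 => w _;
  rewrite lee_fin.
Qed.

Lemma integral_le_affine1 (R : realType) (dT : measure_display)
    (T : measurableType dT) (P : probability T R) (X Y : T -> R) (a c A : R) :
  measurable_fun setT X -> measurable_fun setT Y ->
  (forall w, 0 <= X w) -> (forall w, 0 <= Y w) -> 0 <= a -> 0 <= c ->
  (forall w, X w <= a * Y w + c) -> (\int[P]_w (Y w)%:E <= A%:E)%E ->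
  (\int[P]_w (X w)%:E <= (a * A + c)%:E)%E.
Proof.
move=> mX mY X0 Y0 a0 c0 H HY.
have -> : a * A + c = a * A + 0 * 0 + c by rewrite mulr0 addr0.
apply: (@integral_le_affine _ _ _ _ X Y (cst 0)) => //.
- by move=> w; rewrite mulr0 addr0.
- by rewrite /cst integral0.
Qed.

(** * The scalar inequalities behind the three recursions *)

Section ScalarRecursions.
Context (R : realFieldType).

(** With [t = 1/d], the net contraction [1 - t/2] removes [96 d Z] from [192 d^2 Z], while the drift
    [16 (1 + 2 d) Z] returns at most [48 d Z]. The remaining [48 d Z] pays for the growth of [q] in
    [memory_recursion]. *)
Lemma memory_contraction (d t V Z H : R) : 0 < t -> t <= 1 -> t * d = 1 ->
  1 <= d -> 0 <= V -> 0 <= Z -> H <= 4 * V + 192 * d ^+ 2 * Z ->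
  (1 + t / 2) * ((1 - t) * H + V * t) + (1 + 2 * d) * (16 * Z) <=
  4 * V + (192 * d ^+ 2 - 48 * d) * Z.
Proof.
move=> t0 t1 td d1 V0 Z0 HH.
have W0 : 0 <= 4 * V + 192 * d ^+ 2 * Z.
  apply: addr_ge0; first exact: mulr_ge0.
  by apply: mulr_ge0 => //; apply: mulr_ge0 => //; exact: sqr_ge0.
have tH : (1 + t / 2) * (1 - t) * H <= (1 - t / 2) * (4 * V + 192 * d ^+ 2 * Z).
  have a0 : 0 <= (1 + t / 2) * (1 - t) by apply: mulr_ge0; lra.
  apply: le_trans (ler_wpM2l a0 HH) _; apply: ler_wpM2r => //.
  by have := sqr_ge0 t; lra.
have tV0 : 0 <= t * V by rewrite mulr_ge0// ltW.
have tV : t * V * t <= t * V by rewrite ler_piMr.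
have tdZ : t * d ^+ 2 * Z = d * Z by rewrite -[RHS]mul1r -td; ring.
have dZ : Z <= d * Z by rewrite ler_peMl.
have E : (1 - t / 2) * (4 * V + 192 * d ^+ 2 * Z) =
  4 * V + 192 * d ^+ 2 * Z - 2 * (t * V) - 96 * (t * d ^+ 2 * Z) by field.
move: tH; rewrite E tdZ; lra.
Qed.

(* Here q = y_k^3 = 4 / gamma_k, and the weight 1/(2d) splits the drift of the
   gradient from the memory error. *)
Lemma memory_recursion (d q V X H : R) : 1 <= d -> 8 * d <= q -> 0 <= V ->
  0 <= X ->
  H <= 4 * V + 192 * d ^+ 2 * X / q ^+ 2 ->
  (1 + (2 * d)^-1) * ((1 - d^-1) * H + V / d)
    + (1 + ((2 * d)^-1)^-1) * (X * (4 / q) ^+ 2) <=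
  4 * V + 192 * d ^+ 2 * X / (q + 1) ^+ 2.
Proof.
move=> d1 dq V0 X0 HH.
have d0 : 0 < d by lra.
have q0 : 0 < q by lra.
have E1 : (2 * d)^-1 = d^-1 / 2 by rewrite invfM mulrC.
have E2 : X * (4 / q) ^+ 2 = 16 * (X / q ^+ 2) by field; rewrite gt_eqF.
rewrite invrK E2 E1.
apply: le_trans (memory_contraction _ _ _ d1 V0 _ _) _.
- by rewrite invr_gt0.
- by rewrite invf_le1.
- by rewrite mulVf ?gt_eqF.
- by rewrite divr_ge0// sqr_ge0.
- by rewrite mulrA.
have q1 : 0 < (q + 1) ^+ 2 by rewrite exprn_gt0// addr_gt0.
rewrite lerD2l ler_pdivlMr//.
have -> : (192 * d ^+ 2 - 48 * d) * (X / q ^+ 2) * (q + 1) ^+ 2 =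
    (192 * d ^+ 2 - 48 * d) * X * (q + 1) ^+ 2 / q ^+ 2.
  by field; rewrite gt_eqF.
rewrite ler_pdivrMr ?exprn_gt0//.
(* The difference of the sides is [q (q - 8 d) + 2 q - 4 d + 1]. Multiplying by [48 d X] gives the
   two coefficients of the goal. *)
have H1 : (4 * d - 1) * (q + 1) ^+ 2 <= 4 * d * q ^+ 2.
  have : 0 <= q * (q - 8 * d) by rewrite mulr_ge0 ?subr_ge0// ltW.
  nra.
have dX0 : 0 <= 48 * d * X by rewrite !mulr_ge0// ltW.
have := ler_wpM2l dX0 H1; nra.
Qed.

(* Here z = 1 / y_k^2 = eta_k / 4. The constants 80 and 52 are forced by the
   extra terms 240 dV + 156 X of one step, which have to be 3 (80 dV + 52 X). *)
Lemma average_recursion_le (z d V X B2 e H : R) : 0 < z -> 4 * z <= 1 ->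
  1 <= d ->
  0 <= V -> 0 <= X -> 0 <= B2 -> d * H <= 4 * d * V + 3 * X ->
  e <= 3 * B2 + (80 * (d * V) + 52 * X) * z ->
  (1 - 4 * z) * (1 - 4 * z / 2) * e + 2 * (4 * z) * B2
    + (4 * z) ^+ 2 * (2 * d * H + 2 * d * V) <=
  (1 - 4 * z) * (1 - 2 * z) * (3 * B2 + (80 * (d * V) + 52 * X) * z) + 8 * z * B2
    + 16 * z ^+ 2 * (10 * (d * V) + 6 * X).
Proof.
move=> z0 z1 d1 V0 X0 B0 HH He.
have a0 : 0 <= (1 - 4 * z) * (1 - 2 * z) by apply: mulr_ge0; lra.
have := ler_wpM2l a0 He; have := ler_wpM2l (sqr_ge0 z) HH; lra.
Qed.

(** Concerns [g k.+1] against the gradient at [x k], before the drift: the gap recursion only needs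
    that this error is no larger than the bound of step [k]. *)
Lemma average_recursion_weak (z W X B2 M : R) : 0 < z -> 4 * z <= 1 ->
  0 <= W -> 0 <= X -> 0 <= B2 -> M = 80 * W + 52 * X ->
  (1 - 4 * z) * (1 - 2 * z) * (3 * B2 + M * z) + 8 * z * B2
    + 16 * z ^+ 2 * (10 * W + 6 * X) <= 3 * B2 + M * z.
Proof.
move=> z0 z1 W0 X0 B0 ME.
have M0 : 0 <= M by rewrite ME addr_ge0// mulr_ge0.
have U0 : 0 <= 3 * B2 + M * z by rewrite addr_ge0 ?mulr_ge0// ltW.
have a0 : 0 <= (1 - 4 * z) * z * (3 * B2 + M * z).
  by apply: mulr_ge0 => //; apply: mulr_ge0; lra.
have z2 := sqr_ge0 z.
have zB : 0 <= z * B2 by rewrite mulr_ge0// ltW.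
have zW : 0 <= z ^+ 2 * W by rewrite mulr_ge0.
have zX : 0 <= z ^+ 2 * X by rewrite mulr_ge0.
have : (1 - 4 * z) * (1 - 2 * z) * (3 * B2 + M * z) <=
  (1 - 4 * z) * (3 * B2 + M * z).
  lra.
have : z ^+ 2 * M = 80 * (z ^+ 2 * W) + 52 * (z ^+ 2 * X).
  by rewrite ME; ring.
lra.
Qed.

(** The balance at order [z^2] is exact: the contraction removes [4 z^2 M], sampling noise, memory
    and drift return at most [3 z^2 M], and the last [z^2 M] covers the passage from [z] to [z'].
    The floor [3 B2] is fixed in the same way, as [4 z] times it is the [12 z B2] put back. *)
Lemma average_recursion (z z' W X B2 M G : R) : 0 < z -> 4 * z <= 1 ->
  0 <= W -> 0 <= X -> 0 <= B2 -> M = 80 * W + 52 * X -> z - z ^+ 2 <= z' ->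
  G <= (1 - 4 * z) * (1 - 2 * z) * (3 * B2 + M * z) + 8 * z * B2
    + 16 * z ^+ 2 * (10 * W + 6 * X) ->
  (1 + 4 * z / 2) * G + (1 + (4 * z / 2)^-1) * (X * (16 * z ^+ 3)) <=
  3 * B2 + M * z'.
Proof.
move=> z0 z1 W0 X0 B0 ME zz' HG.
have M0 : 0 <= M by rewrite ME addr_ge0// mulr_ge0.
have U0 : 0 <= 3 * B2 + M * z by rewrite addr_ge0 ?mulr_ge0// ltW.
have E1 : (1 + (4 * z / 2)^-1) * (X * (16 * z ^+ 3)) =
  X * (16 * z ^+ 3 + 8 * z ^+ 2).
  by field; rewrite gt_eqF.
have z2 := sqr_ge0 z.
have zB : 0 <= z * B2 by rewrite mulr_ge0// ltW.
have zW : 0 <= z ^+ 2 * W by rewrite mulr_ge0.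
have zX : 0 <= z ^+ 2 * X by rewrite mulr_ge0.
have z3X : 4 * (z ^+ 3 * X) <= z ^+ 2 * X.
  by have := ler_wpM2l zX z1; rewrite (exprS z 2); lra.
have z3W : 4 * (z ^+ 3 * W) <= z ^+ 2 * W.
  by have := ler_wpM2l zW z1; rewrite (exprS z 2); lra.
have z2B : 4 * (z ^+ 2 * B2) <= z * B2.
  by have := ler_wpM2l zB z1; rewrite expr2; lra.
have a0 : 0 <= z ^+ 2 * (1 - 4 * z) * (3 * B2 + M * z).
  by apply: mulr_ge0 => //; apply: mulr_ge0 => //; lra.
have HG' : (1 + 2 * z) * G <= (1 - 4 * z) * (3 * B2 + M * z) + 12 * (z * B2)
    + 240 * (z ^+ 2 * W) + 144 * (z ^+ 2 * X).
  have b0 : 0 <= 1 + 2 * z by lra.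
  apply: le_trans (ler_wpM2l b0 HG) _.
  by move: a0 z3X z3W z2B; rewrite !exprS expr0; lra.
have := ler_wpM2l M0 zz'.
have zM : z ^+ 2 * M = 80 * (z ^+ 2 * W) + 52 * (z ^+ 2 * X) by rewrite ME;
  ring.
rewrite E1; move: HG' z3X zM; rewrite mulrBr; lra.
Qed.

(** The contraction removes [4 w^4 A] and the decrease of [w] takes [w^4 A]. The remaining [3 w^4 A]
    pays for [4 w^4 D m0] and for the quadratic term [16 w^6 L D^2], at most [4 w^4 L D^2]. The bias
    term [Bh D] reproduces itself. *)
Lemma gap_recursion (w w' A m0 L D Bh F : R) : 0 < w -> 4 * w ^+ 2 <= 1 ->
  0 <= L -> 4 * w ^+ 3 <= 1 -> w - w ^+ 4 <= w' -> 0 <= A ->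
  4 * D * m0 + 4 * (L * D ^+ 2) <= 3 * A -> F <= Bh * D + A * w ->
  (1 - 4 * w ^+ 3) * F + 4 * w ^+ 3 * D * (Bh + m0 * w)
    + L * (D * (4 * w ^+ 3)) ^+ 2 <= Bh * D + A * w'.
Proof.
move=> w0 w2 L0 w3 ww' A0 HA HF.
have a0 : 0 <= 1 - 4 * w ^+ 3 by lra.
have := ler_wpM2l a0 HF; have := ler_wpM2l A0 ww'.
have w40 : 0 <= w ^+ 4 by rewrite exprn_ge0// ltW.
have LD0 : 0 <= L * D ^+ 2 by rewrite mulr_ge0// sqr_ge0.
have := ler_wpM2l w40 HA; have := ler_wpM2l (mulr_ge0 w40 LD0) w2.
rewrite !exprS expr0; lra.
Qed.

(** Majorizes the mean squared error by an explicit square, whose root can be fed to [gap_step]. The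
    constants fit because [16^2 >= 240], [8^2 >= 52] and [3 d b2 <= 6 d b^2 <= (3 r b)^2]. *)
Lemma estimator_bound (d r w s gr b b2 X Y V M : R) : 1 <= d -> r ^+ 2 = d ->
  0 <= w -> 0 <= r -> 0 <= s -> 0 <= gr -> 0 <= b -> b2 <= 2 * b ^+ 2 ->
  0 <= Y -> X = Y ^+ 2 ->
  V = 3 * (d * s ^+ 2 + gr ^+ 2 + d * b2) -> M = 80 * (d * V) + 52 * X ->
  3 * (d * b2) + M * w ^+ 2 <=
  (3 * r * b + (16 * (d * s + d * gr + 2 * d * b) + 8 * Y) * w) ^+ 2.
Proof.
move=> d1 rd w0 r0 s0 g0 b0 bb Y0 XE VE ME.
have d0 : 0 <= d by lra.
set m0 := _ + 8 * Y.
have ds : 0 <= d * s by exact: mulr_ge0.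
have dg : 0 <= d * gr by exact: mulr_ge0.
have db : 0 <= d * b by exact: mulr_ge0.
have m00 : 0 <= m0 by rewrite /m0; lra.
have mm : M <= m0 ^+ 2.
  have h1 := mulr_ge0 ds dg; have h2 := mulr_ge0 ds db;
    have h3 := mulr_ge0 ds Y0.
  have h4 := mulr_ge0 dg db; have h5 := mulr_ge0 dg Y0;
    have h6 := mulr_ge0 db Y0.
  have k1 : d ^+ 2 * b2 <= 2 * (d * b) ^+ 2.
    by rewrite exprMn mulrCA ler_wpM2l ?sqr_ge0.
  have k2 : d * gr ^+ 2 <= (d * gr) ^+ 2.
    by rewrite exprMn ler_wpM2r ?sqr_ge0// expr2 ler_peMl.
  have ->: M = 240 * ((d * s) ^+ 2 + d * gr ^+ 2 + d ^+ 2 * b2) + 52 * Y ^+ 2.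
    by rewrite ME VE XE; ring.
  have := sqr_ge0 (d * s); have := sqr_ge0 (d * gr); have := sqr_ge0 (d * b).
  have := sqr_ge0 Y; rewrite /m0; nra.
have rb0 : 0 <= 3 * r * b by rewrite !mulr_ge0.
have mw0 : 0 <= m0 * w by exact: mulr_ge0.
have cr := mulr_ge0 rb0 mw0.
have : d * b2 <= 2 * (d * b ^+ 2) by rewrite mulrCA ler_wpM2l.
have : (3 * r * b) ^+ 2 = 9 * (d * b ^+ 2) by rewrite -rd; ring.
have : 0 <= d * b ^+ 2 by rewrite mulr_ge0// sqr_ge0.
have := ler_wpM2r (sqr_ge0 w) mm; rewrite -exprMn sqrrD; lra.
Qed.

End ScalarRecursions.

Lemma convex_setE (R : realType) (d : nat) (Q : set 'rV[R]_d) x y (t : R) :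
  convex_set Q -> 0 <= t -> t <= 1 -> Q x -> Q y -> Q (x + t *: (y - x)).
Proof.
move=> cQ t0 t1 Qx Qy.
have t01 : Itv.spec (@Itv.num_sem R) (Itv.Real `[0, 1]%Z) t.
  by rewrite /Itv.num_sem/= realE t0/= in_itv/= t0 t1.
have := @cQ y x (Itv.Def t01) (mem_set Qy) (mem_set Qx).
rewrite inE; suff -> : x + t *: (y - x) = t *: y + (1 - t) *: x by [].
by rewrite scalerBr scalerBl scale1r addrCA.
Qed.

(** * One step of the algorithm in mean square and in mean gap *)

Section Steps.
Context (R : realType) (d : nat) (dO dX : measure_display)
  (Omega : measurableType dO) (Xi : measurableType dX).
Context (P : probability Omega R) (pi : probability Xi R) (fb : feedback).
Context (Q : set 'rV[R]_d) (F : 'rV[R]_d -> Xi -> R) (tau : R)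
  (gamma eta : nat -> R) (Fk : nat -> set_system Omega)
  (xi0p xi0m : 'I_d -> Omega -> Xi)
  (idx : nat -> Omega -> 'I_d) (xip xim : nat -> Omega -> Xi)
  (x0 : 'rV[R]_d) (x h g s : nat -> Omega -> 'rV[R]_d).
Hypothesis d0 : (0 < d)%N.
Hypothesis mF : jointly_measurable F.
Hypothesis S : jaguar_sampling fb P pi Fk xi0p xi0m idx xip xim.
Hypothesis A : fw_jaguar Q F tau gamma eta Fk xi0p xi0m idx xip xim x0 x h g s.
Hypothesis xQ : forall k w, Q (x k w).
Context (G : 'rV[R]_d -> 'rV[R]_d) (b2 V : R).
Hypothesis mG : forall i, measurable_fun setT (fun y : borel_rV R d => G y 0 i).

(* G plays the role of the gradient of the mean objective. *)
Definition fd_noise y i xp xm : R :=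
  (F (y + tau *: evec i) xp - F (y - tau *: evec i) xm) / (2 * tau) - G y 0 i.

Hypothesis noise : forall k y, Q y ->
  [/\ forall i, square_integrable P (fun w => fd_noise y i (xip k w) (xim k w)),
      forall i, (\int[P]_w fd_noise y i (xip k w) (xim k w)) ^+ 2 <= b2 &
      \sum_i \int[P]_w (fd_noise y i (xip k w) (xim k w) ^+ 2) <= V].

Local Notation past k := (g_sigma_algebraType (Fk k)).
Local Notation a k w := (G (x k w) - h k w).
Local Notation u k w := (g k w - G (x k w)).

Lemma coord_diffE i y xp xm :
  coord_diff F tau i y xp xm = (G y 0 i + fd_noise y i xp xm) *: evec i.
Proof. by rewrite /coord_diff /fd_noise subrKC. Qed.

Lemma memory_update k w : let i := idx k w in
  G (x k w) - h k.+1 w =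
  a k w + (- ((a k w) 0 i + fd_noise (x k w) i (xip k w) (xim k w))) *: evec i.
Proof.
rewrite /= (step_h A) dot_evec coord_diffE; apply/rowP => j; rewrite !mxE; ring.
Qed.

Lemma average_update k w : let i := idx k w in
  g k.+1 w - G (x k w) =
  ((1 - eta k) *: u k w - eta k *: a k w) +
  (eta k * d%:R * ((a k w) 0 i + fd_noise (x k w) i (xip k w) (xim k w))) *: evec i.
Proof.
rewrite /= (step_g A) /jaguar_rho dot_evec coord_diffE.
apply/rowP => j; rewrite !mxE; ring.
Qed.

Lemma measurable_enorm_sqr (dT : measure_display) (T : measurableType dT)
    (v : T -> 'rV[R]_d) : (forall j, measurable_fun setT (fun t => v t 0 j)) ->
  measurable_fun setT (fun t => enorm (v t) ^+ 2).
Proof.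
move=> mv; under eq_fun do rewrite enorm_sqr.
by apply: measurable_sum => j; exact: measurable_funX.
Qed.

Lemma adapted_target k j : measurable_fun setT (fun w : past k =>
  G (x k w) 0 j).
Proof.
have [ax _ _] := iterates_adapted mF S A k.
have mx : measurable_fun setT (fun w : past k => x k w : borel_rV R d).
  by apply: measurable_fun_rV.
exact: (measurableT_comp (mG j) mx).
Qed.

Lemma adapted_memory_error k j : measurable_fun setT (fun w : past k =>
  (a k w) 0 j).
Proof.
have [_ ah _] := iterates_adapted mF S A k.
rewrite (_ : (fun w => _) = (fun w : past k => G (x k w) 0 j - h k w 0 j)).
  by apply: measurable_funB => //; exact: adapted_target.
by apply/funext => w; rewrite !mxE.
Qed.

Lemma adapted_average_error k j : measurable_fun setT (fun w : past k =>
  (u k w) 0 j).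
Proof.
have [_ _ ag] := iterates_adapted mF S A k.
rewrite (_ : (fun w => _) = (fun w : past k => g k w 0 j - G (x k w) 0 j)).
  by apply: measurable_funB => //; exact: adapted_target.
by apply/funext => w; rewrite !mxE.
Qed.

Lemma measurable_fd_noise k i : measurable_fun setT
  (fun q : past k * (Xi * Xi) => fd_noise (x k q.1) i q.2.1 q.2.2).
Proof.
have [ax _ _] := iterates_adapted mF S A k.
apply: measurable_funB;
  last exact: (measurableT_comp (adapted_target i) measurable_fst).
apply: measurable_funM => //; apply: measurable_funB;
  apply: measurable_oracle => //.
- by move=> j; exact: (measurableT_comp (ax j) measurable_fst).
- exact: (measurableT_comp measurable_fst measurable_snd).
- by move=> j; exact: (measurableT_comp (ax j) measurable_fst).
- exact: (measurableT_comp measurable_snd measurable_snd).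
Qed.

Lemma measurable_of_past k (X : Omega -> R) :
  measurable_fun setT (X : past k -> R) -> measurable_fun setT X.
Proof.
apply: measurable_sub_sigma; first exact: (filtration_sigma S).
exact: (filtration_measurable S).
Qed.


Lemma variance_bound_ge0 : 0 <= V.
Proof.
have [_ _] := noise 0 (xQ 0 point); apply: le_trans.
by apply: sumr_ge0 => i _; exact: mean_sqr_ge0.
Qed.

(** The terms linear in the noise cancel in the refreshed entry; the coefficient 0 is kept to match
    [integral_affine2]. *)
Let Phim k (i : 'I_d) (w : past k) xp xm : R :=
  (enorm (a k w) ^+ 2 - (a k w) 0 i ^+ 2) + 0 * fd_noise (x k w) i xp xm
  + 1 * fd_noise (x k w) i xp xm ^+ 2.

Let PhimE k i w xp xm : @Phim k i w xp xm =
  enorm (a k w + (- ((a k w) 0 i + fd_noise (x k w) i xp xm)) *: evec i) ^+ 2.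
Proof. rewrite enormD_evec /Phim; ring. Qed.

Lemma memory_step k (M : R) :
  (\int[P]_w (enorm (a k w) ^+ 2)%:E <= M%:E)%E ->
  (\int[P]_w (enorm (G (x k w) - h k.+1 w) ^+ 2)%:E <=
    ((1 - d%:R^-1) * M + V / d%:R)%:E)%E.
Proof.
move=> HM; have d0' : (0 : R) < d%:R by rewrite ltr0n.
have d1 : 0 <= 1 - d%:R^-1 :> R by rewrite subr_ge0 invf_le1// ler1n.
have mfst j : measurable_fun setT (fun q : past k * (Xi * Xi) => (a k q.1) 0 j).
  exact: (measurableT_comp (adapted_memory_error j) measurable_fst).
have V0 := variance_bound_ge0.
have mE : measurable_fun setT (fun w : Omega => enorm (a k w) ^+ 2).
  apply: measurable_of_past; apply: measurable_enorm_sqr.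
  exact: adapted_memory_error.
pose Psi (w : Omega) := (1 - d%:R^-1) * enorm (a k w) ^+ 2 + V / d%:R.
have Psi0 w : 0 <= Psi w.
  by apply: addr_ge0; [apply: mulr_ge0 => //; exact: sqr_ge0|exact: divr_ge0].
under eq_integral do rewrite memory_update -PhimE.
apply: (@le_trans _ _ (\int[P]_w (Psi w)%:E)%E).
  apply: (conditional_bound d0 S (Phi := @Phim k)) => //.
  - move=> i; rewrite /Phim; have mn := @measurable_fd_noise k i.
    apply: measurable_funD; last first.
      by apply: measurable_funM => //; exact: measurable_funX.
    apply: measurable_funD; last exact: measurable_funM.
    apply: measurable_funB; last exact: measurable_funX.
    exact: measurable_enorm_sqr.
  - by move=> i w xp xm; rewrite PhimE sqr_ge0.
  - by apply: measurable_funD => //; apply: measurable_funM.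
  move=> w; have [sn bn nV] := noise k (xQ k w).
  under eq_bigr do rewrite integral_affine2// -EFinM.
  rewrite sumEFin lee_fin; under eq_bigr do rewrite mul0r addr0 mul1r.
  exact: mean_memory_update.
apply: integral_le_affine1 HM => //.
- by apply: measurable_funD => //; apply: measurable_funM.
- by move=> w; exact: sqr_ge0.
- exact: divr_ge0.
Qed.

Let c_ k w := (1 - eta k) *: u k w - eta k *: a k w.

(** Unlike for the memory, the linear coefficient survives, and it is through it that the mean of
    the noise, the bias, enters. *)
Let Phig k (i : 'I_d) (w : past k) xp xm : R :=
  (enorm (c_ k w) ^+ 2 + 2 * (eta k * d%:R * (a k w) 0 i) * (c_ k w) 0 i
    + (eta k * d%:R * (a k w) 0 i) ^+ 2)
  + (2 * (eta k * d%:R) * (c_ k w) 0 i + 2 * (eta k * d%:R) ^+ 2 * (a k w) 0 i)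
    * fd_noise (x k w) i xp xm
  + (eta k * d%:R) ^+ 2 * fd_noise (x k w) i xp xm ^+ 2.

Let PhigE k i w xp xm : @Phig k i w xp xm =
  enorm (c_ k w + (eta k * d%:R * ((a k w) 0 i + fd_noise (x k w) i xp xm))
    *: evec i) ^+ 2.
Proof. rewrite enormD_evec /Phig; ring. Qed.

Lemma bias_bound_ge0 : 0 <= b2.
Proof.
have [_ + _] := noise 0 (xQ 0 point); move=> /(_ (Ordinal d0)).
by apply: le_trans; exact: sqr_ge0.
Qed.

Lemma average_step k (E M : R) : 0 <= eta k -> eta k <= 1 ->
  (\int[P]_w (enorm (u k w) ^+ 2)%:E <= E%:E)%E ->
  (\int[P]_w (enorm (a k w) ^+ 2)%:E <= M%:E)%E ->
  (\int[P]_w (enorm (g k.+1 w - G (x k w)) ^+ 2)%:E <=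
    ((1 - eta k) * (1 - eta k / 2) * E + 2 * eta k * (d%:R * b2)
     + eta k ^+ 2 * (2 * d%:R * M + 2 * d%:R * V))%:E)%E.
Proof.
move=> e0 e1 HE HM; have d0' : (0 : R) < d%:R by rewrite ltr0n.
have V0 := variance_bound_ge0; have b0 := bias_bound_ge0.
have ma j := adapted_memory_error (k := k) j.
have mu j := adapted_average_error (k := k) j.
have mc j : measurable_fun setT (fun w : past k => c_ k w 0 j).
  rewrite (_ : (fun w => _) = (fun w : past k =>
    (1 - eta k) * (u k w) 0 j - eta k * (a k w) 0 j)).
    by apply: measurable_funB; apply: measurable_funM.
  by apply/funext => w; rewrite /c_ !mxE.
have ma2 j : measurable_fun setT (fun q : past k * (Xi * Xi) => (a k q.1) 0 j).
  exact: (measurableT_comp (ma j) measurable_fst).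
have mc2 j : measurable_fun setT (fun q : past k * (Xi * Xi) => (c_ k q.1) 0 j).
  exact: (measurableT_comp (mc j) measurable_fst).
have mEa : measurable_fun setT (fun w : Omega => enorm (a k w) ^+ 2).
  by apply: (@measurable_of_past k); exact: measurable_enorm_sqr.
have mEu : measurable_fun setT (fun w : Omega => enorm (u k w) ^+ 2).
  by apply: (@measurable_of_past k); exact: measurable_enorm_sqr.
have c1 : 0 <= (1 - eta k) * (1 - eta k / 2) by apply: mulr_ge0; lra.
have c2 : 0 <= eta k ^+ 2 * (2 * d%:R).
  by apply: mulr_ge0; [exact: sqr_ge0|rewrite mulr_ge0// ltW].
have c3 : 0 <= 2 * eta k * (d%:R * b2) + eta k ^+ 2 * (2 * d%:R) * V.
  apply: addr_ge0; last exact: mulr_ge0 c2 V0.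
  by apply: mulr_ge0; apply: mulr_ge0 => //; exact: ltW.
pose Psi (w : Omega) := (1 - eta k) * (1 - eta k / 2) * enorm (u k w) ^+ 2
  + eta k ^+ 2 * (2 * d%:R) * enorm (a k w) ^+ 2
  + (2 * eta k * (d%:R * b2) + eta k ^+ 2 * (2 * d%:R) * V).
have Psi0 w : 0 <= Psi w.
  by apply: addr_ge0 => //; apply: addr_ge0; apply: mulr_ge0 => //;
    exact: sqr_ge0.
have mPsi : measurable_fun setT Psi.
  by apply: measurable_funD => //; apply: measurable_funD;
    apply: measurable_funM.
under eq_integral do rewrite average_update -/(c_ _ _) -PhigE.
apply: (@le_trans _ _ (\int[P]_w (Psi w)%:E)%E).
  apply: (conditional_bound d0 S (Phi := @Phig k)) => //.
  - move=> i; rewrite /Phig; have mn := @measurable_fd_noise k i.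
    apply: measurable_funD; last first.
      by apply: measurable_funM => //; exact: measurable_funX.
    apply: measurable_funD.
      apply: measurable_funD; last first.
        by apply: measurable_funX; apply: measurable_funM.
      apply: measurable_funD; first exact: measurable_enorm_sqr.
      by apply: measurable_funM => //; apply: measurable_funM => //;
        apply: measurable_funM.
    apply: measurable_funM => //; apply: measurable_funD;
      exact: measurable_funM.
  - by move=> i w xp xm; rewrite PhigE sqr_ge0.
  move=> w; have [sn bn nV] := noise k (xQ k w).
  under eq_bigr do rewrite integral_affine2// -EFinM.
  rewrite sumEFin lee_fin.
  apply: le_trans (mean_average_update d0 e0 e1 _ bn nV (erefl (c_ k w))) _.
    by move=> i; exact: sqr_mean_le.
  rewrite /Psi; lra.
apply: le_trans (integral_le_affine mPsi mEu mEa Psi0 _ _ c1 c2 c3 (fun=> lexx _) HE HM) _.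
- by move=> w; exact: sqr_ge0.
- by move=> w; exact: sqr_ge0.
rewrite lee_fin; lra.
Qed.

Lemma measurable_target k j : measurable_fun setT (fun w : Omega =>
  G (x k w) 0 j).
Proof. by apply: (@measurable_of_past k); exact: adapted_target. Qed.

Lemma measurable_memory_error k l :
  measurable_fun setT (fun w : Omega => enorm (G (x k w) - h l w) ^+ 2).
Proof.
apply: measurable_enorm_sqr => j.
have [_ ah _] := iterates_adapted mF S A l.
rewrite (_ : (fun w => _) = (fun w => G (x k w) 0 j - h l w 0 j)).
  apply: measurable_funB; first exact: measurable_target.
  exact: measurable_of_past (ah j).
by apply/funext => w; rewrite !mxE.
Qed.

Lemma measurable_average_error k l :
  measurable_fun setT (fun w : Omega => enorm (g l w - G (x k w)) ^+ 2).
Proof.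
apply: measurable_enorm_sqr => j.
have [_ _ ag] := iterates_adapted mF S A l.
rewrite (_ : (fun w => _) = (fun w => g l w 0 j - G (x k w) 0 j)).
  apply: measurable_funB; last exact: measurable_target.
  exact: measurable_of_past (ag j).
by apply/funext => w; rewrite !mxE.
Qed.

Context (L D : R).
Hypothesis L0 : 0 <= L.
Hypothesis lipG : forall y z, Q y -> Q z ->
  enorm (G y - G z) <= L * enorm (y - z).
Hypothesis diamQ : forall y z, Q y -> Q z -> enorm (y - z) <= D.

Lemma target_drift k w : 0 <= gamma k ->
  enorm (G (x k.+1 w) - G (x k w)) ^+ 2 <= (L * D * gamma k) ^+ 2.
Proof.
move=> g0; have [Qs _] := step_s A k w.
have D0 : 0 <= D := le_trans (enorm_ge0 _) (diamQ (xQ k w) (xQ k w)).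
rewrite ler_sqr ?nnegrE ?enorm_ge0 ?mulr_ge0//.
apply: le_trans (lipG (xQ _ _) (xQ _ _)) _.
rewrite (step_x A) addrAC subrr add0r enormZ ger0_norm// -mulrA ler_wpM2l//.
by rewrite mulrC ler_wpM2r// diamQ.
Qed.

Lemma memory_drift k (c B : R) : 0 < c -> 0 <= gamma k ->
  (\int[P]_w (enorm (G (x k w) - h k.+1 w) ^+ 2)%:E <= B%:E)%E ->
  (\int[P]_w (enorm (a k.+1 w) ^+ 2)%:E <=
    ((1 + c) * B + (1 + c^-1) * (L * D * gamma k) ^+ 2)%:E)%E.
Proof.
move=> c0 g0; have ci0 : 0 <= 1 + c^-1 by rewrite addr_ge0// invr_ge0 ltW.
apply: integral_le_affine1.
- exact: measurable_memory_error.
- exact: measurable_memory_error.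
- by move=> w; exact: sqr_ge0.
- by move=> w; exact: sqr_ge0.
- by rewrite addr_ge0// ltW.
- by apply: mulr_ge0 => //; exact: sqr_ge0.
move=> w; have -> : a k.+1 w =
    (G (x k w) - h k.+1 w) + (G (x k.+1 w) - G (x k w)).
  by rewrite [RHS]addrC addrA subrK.
apply: le_trans (enorm_sqrD_le _ _ c0) _.
by rewrite lerD2l ler_wpM2l// target_drift.
Qed.

Lemma average_drift k (c B : R) : 0 < c -> 0 <= gamma k ->
  (\int[P]_w (enorm (g k.+1 w - G (x k w)) ^+ 2)%:E <= B%:E)%E ->
  (\int[P]_w (enorm (u k.+1 w) ^+ 2)%:E <=
    ((1 + c) * B + (1 + c^-1) * (L * D * gamma k) ^+ 2)%:E)%E.
Proof.
move=> c0 g0; have ci0 : 0 <= 1 + c^-1 by rewrite addr_ge0// invr_ge0 ltW.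
apply: integral_le_affine1.
- exact: measurable_average_error.
- exact: measurable_average_error.
- by move=> w; exact: sqr_ge0.
- by move=> w; exact: sqr_ge0.
- by rewrite addr_ge0// ltW.
- by apply: mulr_ge0 => //; exact: sqr_ge0.
move=> w; have -> : u k.+1 w =
    (g k.+1 w - G (x k w)) + (-1) *: (G (x k.+1 w) - G (x k w)).
  by rewrite scaleN1r opprB addrA subrK.
apply: le_trans (enorm_sqrD_le _ _ c0) _.
rewrite lerD2l ler_wpM2l// enormZ normrN1 mul1r.
exact: target_drift.
Qed.

(** The initial vector queries every coordinate once, so its error is exactly the vector of the [d]
    coordinate noises, up to sign. *)
Lemma memory_init (v : 'I_d -> R) :
  (forall i, square_integrable P (fun w =>
    fd_noise x0 i (xi0p i w) (xi0m i w))) ->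
  (forall i, \int[P]_w (fd_noise x0 i (xi0p i w) (xi0m i w) ^+ 2) <= v i) ->
  \sum_i v i <= V ->
  (\int[P]_w (enorm (a 0%N w) ^+ 2)%:E <= V%:E)%E.
Proof.
move=> sn nv vV.
have aE w : enorm (a 0%N w) ^+ 2 =
    \sum_i fd_noise x0 i (xi0p i w) (xi0m i w) ^+ 2.
  rewrite enorm_sqr; apply: eq_bigr => i _.
  rewrite (init_x A) (init_h A) !mxE summxE (bigD1 i)//= big1 ?addr0.
    by rewrite coord_diffE mxE evecE eqxx mulr1 opprD addNKr sqrrN.
  by move=> j ji; rewrite coord_diffE mxE evecE eq_sym (negbTE ji) mulr0.
under eq_integral do rewrite aE -sumEFin.
rewrite ge0_integral_sum//; last 2 first.
- move=> i; apply/measurable_EFinP/measurable_funX; exact: (sn i).1.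
- by move=> i w _; rewrite lee_fin sqr_ge0.
under eq_bigr do rewrite -EFin_mean_sqr//.
rewrite sumEFin lee_fin; apply: le_trans vV.
by apply: ler_sum => i _; exact: nv.
Qed.

Context (m : 'rV[R]_d -> R) (fstar : R).
Hypothesis mm : measurable_fun setT (m : borel_rV R d -> R).
Hypothesis convex_m : forall y z, Q y -> Q z -> m y + dot (G y) (z - y) <= m z.
Hypothesis minm : is_min_on Q m fstar.

Lemma gap_ge0 k w : 0 <= m (x k w) - fstar.
Proof. by rewrite subr_ge0; apply: minm.2; exists (x k w). Qed.

Lemma measurable_gap k : measurable_fun setT (fun w : Omega =>
  m (x k w) - fstar).
Proof.
have [ax _ _] := iterates_adapted mF S A k; apply: measurable_funB => //.
apply: (@measurable_of_past k).
have mx : measurable_fun setT (fun w : past k => x k w : borel_rV R d).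
  by apply: measurable_fun_rV.
exact: (measurableT_comp mm mx).
Qed.

(* Convexity at the new iterate, rather than smoothness at the old one, gives
   the descent inequality without integrating the gradient. *)
Lemma gap_pointwise k w : 0 <= gamma k ->
  m (x k.+1 w) - fstar <= (1 - gamma k) * (m (x k w) - fstar)
    + gamma k * D * enorm (g k.+1 w - G (x k w)) + L * (D * gamma k) ^+ 2.
Proof.
move=> g0; have [Qs smin] := step_s A k w.
have [[xs Qxs mxs] _] := minm.
set y := x k w; set z := x k.+1 w; set gp := g k.+1 w; set sk := s k w.
have Qy : Q y := xQ k w; have Qz : Q z := xQ k.+1 w.
have zy : z - y = gamma k *: (sk - y)
  by rewrite /z (step_x A) addrAC subrr add0r.
have nzy : enorm (z - y) <= D * gamma k.
  by rewrite zy enormZ ger0_norm// mulrC ler_wpM2r// diamQ.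
have c1 := convex_m Qz Qy.
have c2 := convex_m Qy Qxs.
have E1 : dot (G z) (y - z) =
  - gamma k * dot (G y) (sk - y) - dot (G z - G y) (z - y).
  by rewrite -(opprB z y) dotC dotNl dotC zy dotBl !dotZr; ring.
have b1 : dot (G z - G y) (z - y) <= L * (D * gamma k) ^+ 2.
  apply: le_trans (cauchy_schwarz _ _) _.
  rewrite expr2 mulrA; apply: ler_pM => //; try exact: enorm_ge0.
  by apply: le_trans (lipG Qz Qy) _; rewrite ler_wpM2l.
(* With [xs] a minimizer: the first difference is nonpositive by the choice of [sk], the product
   with [gp - G y] is the estimation error, and the last term is at most [fstar - m y] by
   convexity. *)
have E2 : dot (G y) (sk - y) = dot sk gp - dot xs gp + dot (gp - G y) (xs - sk)
    + dot (G y) (xs - y).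
  by rewrite !(dotBl, dotBr) (dotC sk) (dotC xs); ring.
have b2' : dot (gp - G y) (xs - sk) <= D * enorm (gp - G y).
  apply: le_trans (cauchy_schwarz _ _) _.
  by rewrite mulrC ler_wpM2r ?enorm_ge0// diamQ.
have b3 := smin xs Qxs.
have : gamma k * dot (G y) (sk - y) <=
    gamma k * (D * enorm (gp - G y) + (fstar - m y)).
  by apply: ler_wpM2l => //; rewrite E2; rewrite -mxs; lra.
move: c1; rewrite E1 => c1 c4; lra.
Qed.

(** The norm enters linearly but only its second moment is known. By [v <= v^2 / (2 rho) + rho / 2]
    the bound becomes affine in [v^2], and [E <= rho^2] makes the two halves add up to at most
    [rho]. *)
Lemma gap_step k (Fb E rho : R) : 0 <= gamma k -> gamma k <= 1 -> 0 < rho ->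
  (\int[P]_w (m (x k w) - fstar)%:E <= Fb%:E)%E ->
  (\int[P]_w (enorm (g k.+1 w - G (x k w)) ^+ 2)%:E <= E%:E)%E ->
  E <= rho ^+ 2 ->
  (\int[P]_w (m (x k.+1 w) - fstar)%:E <=
    ((1 - gamma k) * Fb + gamma k * D * rho + L * (D * gamma k) ^+ 2)%:E)%E.
Proof.
move=> g0 g1 r0 HF HE Er.
have D0 : 0 <= D := le_trans (enorm_ge0 _) (diamQ (xQ k point) (xQ k point)).
pose b := gamma k * D / (2 * rho);
  pose c := gamma k * D * rho / 2 + L * (D * gamma k) ^+ 2.
have gD : 0 <= gamma k * D by exact: mulr_ge0.
have b0 : 0 <= b by apply: divr_ge0 => //; apply: mulr_ge0 => //; exact: ltW.
have c0 : 0 <= c.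
  apply: addr_ge0; last by apply: mulr_ge0 => //; exact: sqr_ge0.
  by apply: divr_ge0 => //; apply: mulr_ge0 => //; exact: ltW.
have a0 : 0 <= 1 - gamma k by rewrite subr_ge0.
apply: le_trans (integral_le_affine (measurable_gap k.+1) (measurable_gap k)
  (measurable_average_error k k.+1) (gap_ge0 k.+1) (gap_ge0 k) _ a0 b0 c0 _ HF HE) _.
- by move=> w; exact: sqr_ge0.
- move=> w; apply: le_trans (gap_pointwise w g0) _.
  set v := enorm _; rewrite /c addrA lerD2r -addrA lerD2l.
  have -> : b * v ^+ 2 + gamma k * D * rho / 2 =
      gamma k * D * v + b * (v - rho) ^+ 2.
    by rewrite /b; field; rewrite gt_eqF.
  by rewrite lerDl; apply: mulr_ge0 => //; exact: sqr_ge0.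
rewrite lee_fin /c addrA lerD2r -addrA lerD2l.
have rhoE : gamma k * D * rho = b * rho ^+ 2 + gamma k * D * rho / 2.
  by rewrite /b; field; rewrite gt_eqF.
by rewrite [leRHS]rhoE lerD2r ler_wpM2l.
Qed.

(** * The joint induction, with [w k] for [1 / y_k] and [r] for [sqrt d] *)

Context (w : nat -> R) (r b sig gr : R).
Hypothesis w_gt0 : forall k, 0 < w k.
Hypothesis w_le : forall k, 2 * r * w k <= 1.
Hypothesis w_init : 2 * r * w 0 = 1.
Hypothesis w_step : forall k, w k - w k ^+ 4 <= w k.+1.
Hypothesis w2_step : forall k, w k ^+ 2 - w k ^+ 4 <= w k.+1 ^+ 2.
Hypothesis w3_step : forall k, (w k.+1 ^+ 3)^-1 = (w k ^+ 3)^-1 + 1.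
Hypothesis gammaE : forall k, gamma k = 4 * w k ^+ 3.
Hypothesis etaE : forall k, eta k = 4 * w k ^+ 2.
Hypothesis r0 : 0 <= r.
Hypothesis rd : r ^+ 2 = d%:R.
Hypothesis b0 : 0 < b.
Hypothesis b2_le : b2 <= 2 * b ^+ 2.
Hypotheses (sig0 : 0 <= sig) (gr0 : 0 <= gr).
Hypothesis VE : V = 3 * (d%:R * sig ^+ 2 + gr ^+ 2 + d%:R * b2).
Hypothesis init_memory : (\int[P]_w (enorm (a 0%N w) ^+ 2)%:E <= V%:E)%E.

Let D0 : 0 <= D := le_trans (enorm_ge0 _) (diamQ (xQ 0%N point) (xQ 0%N point)).
Let X := (L * D) ^+ 2.
Let M := 80 * (d%:R * V) + 52 * X.
Let m0 := 16 * (d%:R * sig + d%:R * gr + 2 * d%:R * b) + 8 * (L * D).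
Let gap0 := m x0 - fstar.
(** The term [2 r gap0] makes [AA * w 0] at least [gap0], because [2 r w_0 = 1]; the other two
    supply [4 D m0 + 4 L D^2 <= 3 AA], as [gap_recursion] demands. *)
Let AA := 2 * D * m0 + 2 * (L * D ^+ 2) + 2 * r * gap0.

Let d1 : 1 <= d%:R :> R. Proof. by rewrite ler1n. Qed.

Let r1 : 1 <= r.
Proof. by rewrite -ler_sqr ?nnegrE// expr1n rd. Qed.

Let w2_le k : 4 * d%:R * w k ^+ 2 <= 1.
Proof.
have := w_le k; have := w_gt0 k => wk0 H.
have h0 : 0 <= 2 * r * w k by rewrite !mulr_ge0// ltW.
have := mulr_ile1 h0 h0 H H; rewrite -rd; lra.
Qed.

Let q_ge k : 8 * d%:R * r <= (w k ^+ 3)^-1.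
Proof.
have wk0 := w_gt0 k.
have h0 : 0 <= 2 * r * w k by rewrite !mulr_ge0// ltW.
rewrite -[leRHS]mul1r ler_pdivlMr ?exprn_gt0//.
have -> : 8 * d%:R * r * w k ^+ 3 = (2 * r * w k) ^+ 3 by rewrite -rd; ring.
exact: exprn_ile1.
Qed.

Let V0 : 0 <= V := variance_bound_ge0.
Let B0 : 0 <= d%:R * b2. Proof. by rewrite mulr_ge0// bias_bound_ge0. Qed.
Let X0 : 0 <= X. Proof. exact: sqr_ge0. Qed.
Let W0 : 0 <= d%:R * V. Proof. exact: mulr_ge0. Qed.
Let M0 : 0 <= M. Proof. by apply: addr_ge0; apply: mulr_ge0. Qed.
Let LD0 : 0 <= L * D. Proof. exact: mulr_ge0. Qed.

Let m00 : 0 <= m0.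
Proof.
by rewrite /m0; repeat (apply: addr_ge0 || apply: mulr_ge0 => //); exact: ltW.
Qed.

Let gap00 : 0 <= gap0.
Proof. by have := gap_ge0 0 point; rewrite (init_x A). Qed.

Let AA0 : 0 <= AA.
Proof.
by rewrite /AA; repeat (apply: addr_ge0 || apply: mulr_ge0 => //);
  exact: sqr_ge0.
Qed.

Let z4 k : 4 * w k ^+ 2 <= 1.
Proof.
by apply: le_trans (w2_le k); rewrite ler_wpM2r ?sqr_ge0// ler_peMr.
Qed.

Let w2_gt0 k : 0 < w k ^+ 2. Proof. exact: exprn_gt0. Qed.

Let w3_le k : 4 * w k ^+ 3 <= 1.
Proof.
have wk0 := w_gt0 k; have := z4 k.
have wk1 : w k <= 1 by have := sqr_ge0 (w k - 2^-1); have := z4 k; lra.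
have := ler_wpM2l (ltW (w2_gt0 k)) wk1; rewrite exprS mulrC; lra.
Qed.

Let memory_bound k : R := 4 * V + 192 * d%:R ^+ 2 * X / (w k ^+ 3)^-1 ^+ 2.

Let memory_bound_le k : d%:R * memory_bound k <= 4 * d%:R * V + 3 * X.
Proof.
rewrite /memory_bound mulrDr mulrCA mulrA lerD2l exprVn invrK.
have -> : d%:R * (192 * d%:R ^+ 2 * X * (w k ^+ 3) ^+ 2) =
  3 * X * (4 * d%:R * w k ^+ 2) ^+ 3 by ring.
rewrite ler_piMr ?mulr_ge0//; apply: exprn_ile1 => //.
by rewrite !mulr_ge0// ltW.
Qed.

(** The induction is joint because the memory bound feeds the average, and the average, before its
    drift, feeds the gap. *)
Lemma error_bounds k :
  [/\ (\int[P]_w (enorm (a k w) ^+ 2)%:E <= (memory_bound k)%:E)%E,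
      (\int[P]_w (enorm (u k w) ^+ 2)%:E <=
        (3 * (d%:R * b2) + M * w k ^+ 2)%:E)%E &
      (\int[P]_w (m (x k w) - fstar)%:E <= (3 * r * b * D + AA * w k)%:E)%E].
Proof.
have wk0 := w_gt0.
elim: k => [|k [IHa IHu IHg]].
  split.
  - apply: le_trans init_memory _; rewrite lee_fin /memory_bound.
    have hX : 0 <= 192 * d%:R ^+ 2 * X / (w 0 ^+ 3)^-1 ^+ 2.
      apply: divr_ge0; last exact: sqr_ge0.
      by apply: mulr_ge0 => //; apply: mulr_ge0 => //; exact: sqr_ge0.
    by move: V0; lra.
  - under eq_integral => v _.
      rewrite (init_g A) -opprB -scaleN1r enormZ normrN1 mul1r; over.
    apply: le_trans init_memory _; rewrite lee_fin.
    (* Hence [80 d V w_0^2 = 20 V], which covers the initial error [V] of [g 0 = h 0]. *)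
    have wd : 4 * d%:R * w 0 ^+ 2 = 1.
      by rewrite -rd; transitivity ((2 * r * w 0) ^+ 2);
        [ring|rewrite w_init expr1n].
    have -> : M * w 0 ^+ 2 = 20 * V + 52 * X * w 0 ^+ 2.
      by rewrite -[20 * V]mulr1 -[X in 20 * V * X]wd /M; ring.
    have := mulr_ge0 X0 (sqr_ge0 (w 0)); move: V0 B0; lra.
  - under eq_integral do rewrite (init_x A).
    rewrite integral_cst// [X in (_ * X)%E]probability_setT mule1 lee_fin.
    have h1 : AA * w 0 = gap0 + (2 * D * m0 + 2 * (L * D ^+ 2)) * w 0.
      by rewrite /AA -[gap0 in RHS]mulr1 -[X in gap0 * X]w_init; ring.
    have h2 : 0 <= 3 * r * b * D by rewrite !mulr_ge0// ltW.
    have h3 : 0 <= (2 * D * m0 + 2 * (L * D ^+ 2)) * w 0.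
      apply: mulr_ge0; last exact: ltW.
      by apply: addr_ge0; apply: mulr_ge0 => //; apply: mulr_ge0 => //;
        exact: sqr_ge0.
    by rewrite h1 -/gap0; lra.
have wk := wk0 k; have z0 := w2_gt0 k.
have g0 : 0 <= gamma k by rewrite gammaE mulr_ge0// exprn_ge0// ltW.
have g1 : gamma k <= 1 by rewrite gammaE w3_le.
have e0 : 0 <= eta k by rewrite etaE mulr_ge0// ltW.
have e1 : eta k <= 1 by rewrite etaE z4.
have d0' : 0 < d%:R :> R by rewrite ltr0n.
have gap_D : (L * D * gamma k) ^+ 2 = X * (16 * (w k ^+ 2) ^+ 3).
  by rewrite gammaE /X; ring.
have Ha : (\int[P]_w (enorm (a k.+1 w) ^+ 2)%:E <= (memory_bound k.+1)%:E)%E.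
  have c0 : 0 < (2 * d%:R)^-1 :> R by rewrite invr_gt0 mulr_gt0.
  apply: le_trans (memory_drift c0 g0 (memory_step IHa)) _.
  rewrite lee_fin /memory_bound w3_step.
  apply: le_trans (memory_recursion d1 _ V0 X0 (lexx _)).
    have -> : (L * D * gamma k) ^+ 2 = X * (4 / (w k ^+ 3)^-1) ^+ 2.
      by rewrite invrK gammaE /X; ring.
    exact: lexx.
  by apply: le_trans (q_ge k); rewrite ler_peMr ?mulr_ge0.
have HE := average_step e0 e1 IHu IHa.
set G1 := (X in (_ <= X%:E)%E) in HE.
have HG1 : G1 <= (1 - 4 * w k ^+ 2) * (1 - 2 * w k ^+ 2)
    * (3 * (d%:R * b2) + M * w k ^+ 2) + 8 * w k ^+ 2 * (d%:R * b2)
    + 16 * (w k ^+ 2) ^+ 2 * (10 * (d%:R * V) + 6 * X).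
  rewrite /G1 etaE; apply: average_recursion_le => //; exact: memory_bound_le.
have HG2 := average_recursion_weak z0 (z4 k) W0 X0 B0 (erefl M).
split=> //.
- have c0 : 0 < 4 * w k ^+ 2 / 2 by rewrite divr_gt0// mulr_gt0.
  apply: le_trans (average_drift c0 g0 HE) _; rewrite lee_fin gap_D.
  apply: average_recursion HG1 => //.
  by rewrite -exprM; exact: w2_step.
(* The root of the square in [estimator_bound]; it is positive thanks to [0 < b], and [gap_step]
   divides by it. *)
pose rho := 3 * r * b + m0 * w k.
have rho0 : 0 < rho.
  apply: ltr_wpDr; first by rewrite mulr_ge0// ltW.
  by rewrite !mulr_gt0// (lt_le_trans ltr01).
have G1rho : G1 <= rho ^+ 2.
  apply: le_trans HG1 _; apply: le_trans HG2 _.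
  apply: estimator_bound => //; first exact: ltW.
    exact: ltW.
  by rewrite /M /X VE.
apply: le_trans (gap_step g0 g1 rho0 IHg HE G1rho) _; rewrite lee_fin gammaE.
apply: gap_recursion => //.
have rg := mulr_ge0 r0 gap00; have Dm := mulr_ge0 D0 m00.
have LDD := mulr_ge0 L0 (sqr_ge0 D); rewrite /AA; move: rg Dm LDD;
  clearbody m0 gap0.
lra.
Qed.

(** The largest coefficient is that of [r b D]: 3 from the floor, and 32 from [64 d b D w_N] inside
    [AA * w N], since [2 r w_N <= 1] gives [2 d b D w_N <= r b D]. *)
Lemma gap_rate N :
  (\int[P]_w (m (x N w) - fstar)%:E <=
   (35 * ((L * D ^+ 2 + d%:R * sig * D + d%:R * gr * D + r * (m x0 - fstar)) * w N
     + r * b * D))%:E)%E.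
Proof.
have [_ _ H] := error_bounds N; apply: le_trans H _; rewrite lee_fin.
have wN := ltW (w_gt0 N).
have rbD : 0 <= r * b * D by rewrite !mulr_ge0// ltW.
have h1 := ler_wpM2l rbD (w_le N).
have h2 : r * b * D * (2 * r * w N) = 2 * d%:R * b * D * w N by rewrite -rd;
  ring.
have h3 : 0 <= L * D ^+ 2 * w N by rewrite !mulr_ge0// sqr_ge0.
have h4 : 0 <= d%:R * sig * D * w N by rewrite !mulr_ge0.
have h5 : 0 <= d%:R * gr * D * w N by rewrite !mulr_ge0.
have h6 : 0 <= r * gap0 * w N by rewrite !mulr_ge0.
move: h1 h6; rewrite h2 /AA /m0 -/gap0; clearbody gap0; lra.
Qed.

End Steps.

(** * The step sizes of the theorem satisfy the abstract rate conditions *)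

Section StepSizes.
Context (R : realType) (d : nat).
Hypothesis d0 : (0 < d)%N.

Definition jaguar_rate (k : nat) : R :=
  ((k%:R + 8 * d%:R `^ (3 / 2)) `^ (1 / 3))^-1.

Local Notation r := (Num.sqrt d%:R : R).
Local Notation base k := (k%:R + 8 * d%:R `^ (3 / 2) : R).
Local Notation y k := (base k `^ (1 / 3) : R).

Lemma sqrt_dim_sqr : r ^+ 2 = d%:R.
Proof. by rewrite sqr_sqrtr. Qed.

Let r_gt0 : 0 < r. Proof. by rewrite sqrtr_gt0 ltr0n. Qed.

Lemma powR_dim32 : d%:R `^ (3 / 2) = r ^+ 3.
Proof.
have -> : (3 / 2 : R) = 2^-1 * 3 by rewrite mulrC.
by rewrite powRrM powR12_sqrt// powR_mulrn.
Qed.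

Let base_gt0 k : 0 < base k.
Proof. by rewrite powR_dim32 ltr_wpDl// mulr_gt0// exprn_gt0. Qed.

Let y_gt0 k : 0 < y k. Proof. exact: powR_gt0. Qed.

Let y3 k : y k ^+ 3 = base k.
Proof.
rewrite -powR_mulrn ?(ltW (y_gt0 k))// -powRrM mul1r mulVf ?pnatr_eq0//.
by rewrite powRr1// ltW.
Qed.

Let y2 k : base k `^ (2 / 3) = y k ^+ 2.
Proof.
rewrite -powR_mulrn ?(ltW (y_gt0 k))// -powRrM; congr (_ `^ _).
by rewrite mul1r mulrC.
Qed.

Lemma jaguar_rate_gt0 k : 0 < jaguar_rate k.
Proof. by rewrite invr_gt0. Qed.

Lemma jaguar_gammaE k : jaguar_gamma R d k = 4 * jaguar_rate k ^+ 3.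
Proof. by rewrite /jaguar_gamma /jaguar_rate exprVn y3. Qed.

Lemma jaguar_gamma_ge0_le1 k : 0 <= jaguar_gamma R d k <= 1.
Proof.
rewrite /jaguar_gamma divr_ge0//= ?(ltW (base_gt0 k))//.
rewrite ler_pdivrMr// [leRHS]mul1r powR_dim32.
have r1 : 1 <= r by rewrite -ler_sqr ?nnegrE ?(ltW r_gt0)// expr1n sqrt_dim_sqr ler1n.
have := exprn_ege1 3 r1; have : 0 <= k%:R :> R by []; lra.
Qed.

Lemma jaguar_etaE k : jaguar_eta R d k = 4 * jaguar_rate k ^+ 2.
Proof. by rewrite /jaguar_eta /jaguar_rate exprVn y2. Qed.

Lemma jaguar_rate3_step k :
  (jaguar_rate k.+1 ^+ 3)^-1 = (jaguar_rate k ^+ 3)^-1 + 1.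
Proof. by rewrite /jaguar_rate !exprVn !invrK !y3 -natr1; ring. Qed.

Let y_ge k : 2 * r <= y k.
Proof.
rewrite -(ler_pXn2r (n := 3))// ?nnegrE ?(ltW (y_gt0 k)) ?mulr_ge0 ?(ltW r_gt0)//.
by rewrite y3 powR_dim32 exprMn -natrX lerDr.
Qed.

Let y_init : y 0 = 2 * r.
Proof.
apply/eqP; rewrite -(eqrXn2 (n := 3))// ?(ltW (y_gt0 0)) ?mulr_ge0 ?(ltW r_gt0)//.
by rewrite y3 powR_dim32 exprMn -natrX add0r.
Qed.

Let y_le k : y k <= y k.+1.
Proof.
rewrite -(ler_pXn2r (n := 3))// ?nnegrE ?(ltW (y_gt0 _))//.
by rewrite !y3 lerD2r ler_nat.
Qed.

Let y_ge1 k : 1 <= y k.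
Proof.
apply: le_trans (y_ge k); have : 1 <= r.
  by rewrite -ler_sqr ?nnegrE ?(ltW r_gt0)// expr1n sqrt_dim_sqr ler1n.
lra.
Qed.

Lemma jaguar_rate_le k : 2 * r * jaguar_rate k <= 1.
Proof. by rewrite /jaguar_rate ler_pdivrMr// [leRHS]mul1r y_ge. Qed.

Lemma jaguar_rate_init : 2 * r * jaguar_rate 0 = 1.
Proof. by rewrite /jaguar_rate y_init divff// mulf_neq0// gt_eqF. Qed.

Let y3_step k : y k.+1 ^+ 3 = y k ^+ 3 + 1.
Proof. by rewrite !y3 -natr1; ring. Qed.

(** With [v = y_k] and [v' = y_(k+1)], the relation [v'^3 = v^3 + 1] writes [1/v'] as
    [v'^2 / (v^3 + 1)]; the claim becomes [v^6 - 1 <= v'^2 v^4], which follows from [v <= v']. *)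
Lemma jaguar_rate_step k :
  jaguar_rate k - jaguar_rate k ^+ 4 <= jaguar_rate k.+1.
Proof.
rewrite /jaguar_rate; have := y_gt0 k; have := y_gt0 k.+1; have := y_le k.
have := y3_step k; move: (y k) (y k.+1) => v v' E vv v'0 v0.
have -> : v'^-1 = v' ^+ 2 / (v ^+ 3 + 1) by rewrite -E; field; rewrite gt_eqF.
have -> : v^-1 - v^-1 ^+ 4 = (v ^+ 3 - 1) / v ^+ 4 by field; rewrite gt_eqF.
rewrite ler_pdivlMr ?addr_gt0 ?exprn_gt0// mulrAC ler_pdivrMr ?exprn_gt0//.
have H : v ^+ 2 <= v' ^+ 2 by rewrite ler_sqr// nnegrE ltW.
have := ler_wpM2r (ltW (exprn_gt0 4 v0)) H.
have -> : (v ^+ 3 - 1) * (v ^+ 3 + 1) = v ^+ 2 * v ^+ 4 - 1 by ring.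
lra.
Qed.

(** Same device, with [1/v'^2 = v' / (v^3 + 1)]; the leftover [v^2 (v - 1)] has the right sign
    because [y_k >= 1]. *)
Lemma jaguar_rate2_step k :
  jaguar_rate k ^+ 2 - jaguar_rate k ^+ 4 <= jaguar_rate k.+1 ^+ 2.
Proof.
rewrite /jaguar_rate; have := y_gt0 k; have := y_gt0 k.+1; have := y_le k.
have := y_ge1 k; have := y3_step k.
move: (y k) (y k.+1) => v v' E v1 vv v'0 v0.
have -> : v'^-1 ^+ 2 = v' / (v ^+ 3 + 1) by rewrite -E; field; rewrite gt_eqF.
have -> : v^-1 ^+ 2 - v^-1 ^+ 4 = (v ^+ 2 - 1) / v ^+ 4 by field;
  rewrite gt_eqF.
rewrite ler_pdivlMr ?addr_gt0 ?exprn_gt0// mulrAC ler_pdivrMr ?exprn_gt0//.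
have := ler_wpM2r (ltW (exprn_gt0 4 v0)) vv.
have -> : (v ^+ 2 - 1) * (v ^+ 3 + 1) = v * v ^+ 4 - v ^+ 2 * (v - 1) - 1
  by ring.
have := mulr_ge0 (sqr_ge0 v) (_ : 0 <= v - 1); rewrite subr_ge0 => /(_ v1).
lra.
Qed.

End StepSizes.

(** * Feasibility of the iterates and the convergence rate *)

Lemma iterate_in_Q (R : realType) (d : nat) (dO dX : measure_display)
    (Omega : measurableType dO) (Xi : measurableType dX)
    (Q : set 'rV[R]_d) (F : 'rV[R]_d -> Xi -> R) (tau : R)
    (gamma eta : nat -> R) (Fk : nat -> set_system Omega)
    (xi0p xi0m : 'I_d -> Omega -> Xi)
    (idx : nat -> Omega -> 'I_d) (xip xim : nat -> Omega -> Xi)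
    (x0 : 'rV[R]_d) (x h g s : nat -> Omega -> 'rV[R]_d) :
  convex_set Q -> Q x0 -> (forall k, 0 <= gamma k <= 1) ->
  fw_jaguar Q F tau gamma eta Fk xi0p xi0m idx xip xim x0 x h g s ->
  forall k w, Q (x k w).
Proof.
move=> cQ Qx0 g01 A; elim=> [|k IH] w; first by rewrite (init_x A).
have /andP[g0 g1] := g01 k.
by rewrite (step_x A); apply: convex_setE => //; exact: (step_s A k w).1.
Qed.

Theorem theorem6 (R : realType) :
  exists C : R, 0 < C /\
  forall (d : nat) (dO dX : measure_display)
    (Omega : measurableType dO) (P : probability Omega R)
    (Xi : measurableType dX) (pi : probability Xi R)
    (fb : feedback) (Q : set 'rV[R]_d)
    (f delta : 'rV[R]_d -> Xi -> R) (Lxi : Xi -> R)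
    (D L Delta sigma_grad sigma_f tau fstar : R),
  (0 < d)%N ->
  0 < tau ->
  (* measurability, and existence and differentiability of the objective *)
  jointly_measurable f ->
  jointly_measurable delta ->
  (forall x, pi.-integrable setT (EFin \o f x)) ->
  (forall xi x, differentiable (f ^~ xi : 'rV[R]_d -> R^o) x) ->
  (forall x, differentiable (mean pi f : 'rV[R]_d -> R^o) x) ->
  (* (i) *)
  compact Q ->
  convex_set Q ->
  0 < D ->
  (forall x y, Q x -> Q y -> enorm (x - y) <= D) ->
  (* (ii) *)
  (forall x y, Q x -> Q y ->
     mean pi f x + dot (grad (mean pi f) x) (y - x) <= mean pi f y) ->
  (* (iii) *)
  (forall xi, smooth_on (fd_enlargement Q tau) (f ^~ xi) (Lxi xi)) ->
  measurable_fun setT Lxi ->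
  0 <= L ->
  ('E_pi[fun xi => (Lxi xi ^+ 2)%R] = (L ^+ 2)%:E)%E ->
  (* (iv) *)
  0 < Delta ->
  (forall x, fd_enlargement Q tau x ->
     ('E_pi[fun xi => (`|delta x xi| ^+ 2)%R] <= (Delta ^+ 2)%:E)%E) ->
  (* (v) *)
  0 <= sigma_grad ->
  (forall x, Q x ->
     ('E_pi[fun xi => (enorm (grad (f ^~ xi) x - grad (mean pi f) x) ^+ 2)%R]
      <= (sigma_grad ^+ 2)%:E)%E) ->
  (* (vi) *)
  (fb = OnePoint -> 0 <= sigma_f /\
     forall x, Q x ->
       ('E_pi[fun xi => (`|f x xi - mean pi f x| ^+ 2)%R]
        <= (sigma_f ^+ 2)%:E)%E) ->
  (fb = TwoPoint -> sigma_f = 0) ->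
  is_min_on Q (mean pi f) fstar ->
  forall (Fk : nat -> set_system Omega)
    (xi0p xi0m : 'I_d -> Omega -> Xi)
    (idx : nat -> Omega -> 'I_d) (xip xim : nat -> Omega -> Xi)
    (x0 : 'rV[R]_d) (x h g s : nat -> Omega -> 'rV[R]_d),
  Q x0 ->
  jaguar_sampling fb P pi Fk xi0p xi0m idx xip xim ->
  fw_jaguar Q (fun y xi => f y xi + delta y xi) tau
    (jaguar_gamma R d) (jaguar_eta R d) Fk xi0p xi0m idx xip xim x0 x h g s ->
  forall N : nat,
  ('E_P[fun w => (mean pi f (x N w) - fstar)%R] <=
   (C * ((L * D ^+ 2 + d%:R * sigma_f * D / tau + d%:R * sigma_grad * D
            + Num.sqrt d%:R * (mean pi f x0 - fstar))
           / (N%:R + 8 * d%:R `^ (3 / 2)) `^ (1 / 3)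
         + Num.sqrt d%:R * L * D * tau
         + Num.sqrt d%:R * Delta * D / tau))%:E)%E.
Proof.
exists 35; split=> // d dO dX Omega P Xi pi fb Q f delta Lxi D L Delta sg sf tau fstar.
move=> d0 tau0 mf mdelta intf df dm _ cQ D0 diamQ convex_m smooth_f mL L0 EL.
move=> Delta0 Edelta sg0 Egrad Ef sf2 minm Fk xi0p xi0m idx xip xim x0 x h g s.
move=> Qx0 S A N.
rewrite unlock in EL.
have {}Edelta y : fd_enlargement Q tau y ->
    (\int[pi]_xi ((delta y xi) ^+ 2)%:E <= (Delta ^+ 2)%:E)%E.
  move=> Qy; have := Edelta y Qy; rewrite unlock; apply: le_trans.
  by under [leRHS]eq_integral do rewrite real_normK ?num_real//.
have {}Egrad y : Q y ->
    (\int[pi]_xi (enorm (grad (f ^~ xi) y - grad (mean pi f) y) ^+ 2)%:E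
      <= (sg ^+ 2)%:E)%E.
  by move=> Qy; have := Egrad y Qy; rewrite unlock.
have sf0 : 0 <= sf.
  by move: Ef sf2; case: fb S => S; [move=> /(_ erefl)[]|move=> _ ->].
have {}Ef : fb = OnePoint -> forall y, Q y ->
    (\int[pi]_xi ((f y xi - mean pi f y) ^+ 2)%:E <= (sf ^+ 2)%:E)%E.
  move=> /Ef[_ H] y Qy; have := H y Qy; rewrite unlock; apply: le_trans.
  by under [leRHS]eq_integral do rewrite real_normK ?num_real//.
pose F y xi := f y xi + delta y xi.
have mF : jointly_measurable F by exact: measurable_funD mf mdelta.
have g01 := jaguar_gamma_ge0_le1 R d0.
have xQ := iterate_in_Q cQ Qx0 g01 A.
have smooth_m := smooth_on_mean tau0 mf intf df dm smooth_f mL L0 EL.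
(* Smoothing bias plus oracle noise: multiplied by [sqrt d D] it yields the last two terms of the
   rate. *)
pose b := tau * L + Delta / tau.
have tL : 0 <= tau * L by rewrite mulr_ge0// ltW.
have Dt : 0 < Delta / tau by exact: divr_gt0.
pose b2 := bias2 L Delta tau.
pose V := 3 * (d%:R * (sf / tau) ^+ 2 + sg ^+ 2 + d%:R * b2).
have moments (Xp Xm : Omega -> Xi) mXp mXm XpXm y Qy :=
  @oracle_noise_moments _ _ _ _ _ _ P _ _ _ _ _ _ _ _ _ _ _ tau0 mf mdelta intf df dm
    smooth_f mL EL Edelta Egrad Ef Xp Xm mXp mXm XpXm y Qy.
have varV y : Q y -> \sum_i coord_variance pi f L Delta sf tau y i <= V.
  by move=> Qy; exact: (sum_coord_variance_le L Delta sf tau mf df Egrad Qy).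
have mG i : measurable_fun setT (fun y : borel_rV R d =>
  grad (mean pi f) y 0 i).
  exact: measurable_grad_mean.
have noise k y : Q y ->
  [/\ forall i, square_integrable P
        (fun w => fd_noise F tau (grad (mean pi f)) y i (xip k w) (xim k w)),
      forall i, (\int[P]_w fd_noise F tau (grad (mean pi f)) y i (xip k w) (xim
        k w)) ^+ 2 <= b2 &
      \sum_i \int[P]_w (fd_noise F tau (grad (mean pi f)) y i (xip k w) (xim k
        w) ^+ 2) <= V].
  move=> Qy; have [mp mm] := measurable_sample S k.
  have [n1 n2 n3] := moments _ _ mp mm (sample_pair S k) y Qy.
  split=> //; apply: le_trans (varV y Qy); apply: ler_sum => i _; exact: n3.
have b2_le : b2 <= 2 * b ^+ 2.
  by rewrite /b2 /bias2 /b; have := mulr_ge0 tL (ltW Dt); nra.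
have init : (\int[P]_w (enorm (grad (mean pi f) (x 0%N w) - h 0%N w) ^+ 2)%:E <=
  V%:E)%E.
  have m0 i : measurable_fun setT (xi0p i) /\ measurable_fun setT (xi0m i).
    have [ap am] := init_adapted S i; split=> _ B mB; rewrite setTI.
      exact: (filtration_measurable S (ap B mB)).
    exact: (filtration_measurable S (am B mB)).
  have mo i := moments _ _ (m0 i).1 (m0 i).2 (init_pair S i) x0 Qx0.
  apply: (memory_init A (v := coord_variance pi f L Delta sf tau x0)).
  - by move=> i; have [n1 _ _] := mo i; exact: n1.
  - by move=> i; have [_ _ n3] := mo i; exact: n3.
  exact: varV.
have := gap_rate d0 mF S A xQ mG noise L0 smooth_m diamQ (measurable_mean pi mf)
  convex_m minm (jaguar_rate_gt0 R d0) (jaguar_rate_le R d0) (jaguar_rate_init R d0)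
  (jaguar_rate_step R d0) (jaguar_rate2_step R d0) (jaguar_rate3_step R d0)
  (jaguar_gammaE R d0) (jaguar_etaE R d0) (sqrtr_ge0 _) (sqrt_dim_sqr R d)
  (ltr_wpDl tL Dt) b2_le (divr_ge0 sf0 (ltW tau0)) sg0 erefl init N.
rewrite unlock => /le_trans; apply; rewrite lee_fin.
rewrite ler_wpM2l// le_eqVlt; apply/orP; left; apply/eqP.
by rewrite /jaguar_rate /b; ring.
Qed.
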